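(* Let $(w_n)_{n=1}^\infty$ be a bounded sequence of complex numbers and let $T$ be the bounded weighted shift operator on $\ell^2$ given by \[ T(x_1,x_2,x_3,\dots)=(0,w_1x_1,w_2x_2,\dots). \] Then $T$ is absolutely norm attaining if and only if either there is a number $\alpha$ such that all of (i), (ii), (iii) hold: (i) the set $\{|w_n| : n\ge 1\}$ has a unique limit point, namely $\alpha$; (ii) for all $\beta\neq\alpha$, $|w_n|=\beta$ for only finitely many values of $n$; and (iii) $|w_n|<\alpha$ for only finitely many values of $n$; or both of (i'), (ii') hold: (i') $\sigma(|T|)=\{|w_n| : n\ge 1\}$ is a finite set; and (ii') there is only one value of $\beta\in\sigma(|T|)$ such that $|w_n|=\beta$ for infinitely many values of $n$.
   Context: A bounded linear operator $T$ on a complex Hilbert space $H$ is called absolutely norm attaining if for every nonzero closed subspace $M$ of $H$ there exists $x_0$ in the unit ball $M_1=\{x\in M : \|x\|\le 1\}$ of $M$ such that $\|Tx_0\|=\sup\{\|Tx\| : x\in M_1\}$. Here $\ell^2$ is the complex Hilbert space of square-summable sequences indexed by $n\ge 1$, $|T|=(T^*T)^{1/2}$, and $\sigma(|T|)$ is the spectrum of $|T|$. A limit point of a set $S\subseteq\mathbb{R}$ is a point $\alpha$ every neighbourhood of which contains an element of $S$ different from $\alpha$; $\{|w_n| : n\ge 1\}$ is regarded as a set (without multiplicity). *)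

(* Defs.v *)
From HB Require Import structures.
From mathcomp Require Import all_boot all_order all_algebra.
From mathcomp Require Import all_classical all_reals all_analysis.
From mathcomp Require Import complex.
From mathcomp Require Import ring lra.

Set Implicit Arguments.
Unset Strict Implicit.
Unset Printing Implicit Defensive.

Import Order.TTheory GRing.Theory Num.Theory.
Import numFieldNormedType.Exports.
Import ComplexField.Normc.

Local Open Scope classical_set_scope.
Local Open Scope ring_scope.

Section complex_series.
Variable R : realType.
Implicit Types (u v : nat -> R[i]).

Definition csummable u :=
  cvgn (series (fun n => complex.Re (u n))) /\ cvgn (series (fun n => complex.Im (u n))).

(* Sum of a complex series: the real and imaginary parts are summed separately
   because R[i] has no canonical normed-module structure over itself. *)
Definition csum u : R[i] :=
  Complex (limn (series (fun n => complex.Re (u n)))) (limn (series (fun n => complex.Im (u n)))).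

Lemma csummableD u v : csummable u -> csummable v -> csummable (fun n => u n + v n).
Proof.
move=> [ru iu] [rv iv]; split.
  rewrite [X in series X](_ : _ = (fun n => complex.Re (u n)) + (fun n => complex.Re (v n))).
    exact: is_cvg_seriesD.
  by apply/funext => n; rewrite /GRing.add /=; case: (u n) (v n) => [a b] [].
rewrite [X in series X](_ : _ = (fun n => complex.Im (u n)) + (fun n => complex.Im (v n))).
  exact: is_cvg_seriesD.
by apply/funext => n; rewrite /GRing.add /=; case: (u n) (v n) => [a b] [].
Qed.

Lemma csumD u v : csummable u -> csummable v ->
  csum (fun n => u n + v n) = csum u + csum v.
Proof.
move=> [ru iu] [rv iv]; rewrite /csum.
rewrite [X in Complex (limn (series X)) _](_ : _ =
    (fun n => complex.Re (u n)) + (fun n => complex.Re (v n))); last first.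
  by apply/funext => n; rewrite /GRing.add /=; case: (u n) (v n) => [a b] [].
rewrite [X in Complex _ (limn (series X))](_ : _ =
    (fun n => complex.Im (u n)) + (fun n => complex.Im (v n))); last first.
  by apply/funext => n; rewrite /GRing.add /=; case: (u n) (v n) => [a b] [].
by rewrite !lim_seriesD.
Qed.

Let ReZ a u : (fun n => complex.Re (a * u n)) =
  complex.Re a *: (fun n => complex.Re (u n)) + (- complex.Im a) *: (fun n => complex.Im (u n)).
Proof.
by apply/funext => n; rewrite !fctE; case: a (u n) => [a b] [c d] /=;
  rewrite /GRing.scale /= mulNr.
Qed.

Let ImZ a u : (fun n => complex.Im (a * u n)) =
  complex.Re a *: (fun n => complex.Im (u n)) + complex.Im a *: (fun n => complex.Re (u n)).
Proof.
by apply/funext => n; rewrite !fctE; case: a (u n) => [a b] [c d] /=;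
  rewrite /GRing.scale.
Qed.

Lemma csummableZ a u : csummable u -> csummable (fun n => a * u n).
Proof.
by move=> [ru iu]; split; rewrite (ReZ, ImZ); apply: is_cvg_seriesD;
  apply: is_cvg_seriesZ.
Qed.

Lemma csumZ a u : csummable u -> csum (fun n => a * u n) = a * csum u.
Proof.
move=> [ru iu]; rewrite /csum ReZ ImZ.
rewrite !lim_seriesD; do ?exact: is_cvg_seriesZ.
rewrite !lim_seriesZ//.
by case: a => a b /=; rewrite /GRing.mul /= /GRing.scale /= mulNr.
Qed.

Lemma csum_conj u : csummable u -> csum (fun n => (u n)^*) = (csum u)^*.
Proof.
move=> [ru iu]; rewrite /csum.
rewrite [X in Complex (limn (series X)) _](_ : _ = (fun n => complex.Re (u n)));
  last by apply/funext => n; case: (u n).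
rewrite [X in Complex _ (limn (series X))](_ : _ = - (fun n => complex.Im (u n)));
  last by apply/funext => n; rewrite /GRing.opp /=; case: (u n).
by rewrite lim_seriesN.
Qed.


Lemma csummable_le u (f : nat -> R) : (forall n, normc (u n) <= f n) ->
  cvgn (series f) -> csummable u.
Proof.
have Hre (a b : R) : `|a| <= Num.sqrt (a ^+ 2 + b ^+ 2).
  by rewrite -sqrtr_sqr ler_wsqrtr// lerDl sqr_ge0.
have Him (a b : R) : `|b| <= Num.sqrt (a ^+ 2 + b ^+ 2).
  by rewrite -sqrtr_sqr ler_wsqrtr// lerDr sqr_ge0.
move=> uf cf; split; apply: normed_cvg; apply: series_le_cvg cf => n //=.
- by apply: le_trans (uf n); case: (u n) => a b /=; apply: sqrtr_ge0.
- by apply: le_trans (uf n); case: (u n) => a b /=.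
- by apply: le_trans (uf n); case: (u n) => a b /=; apply: sqrtr_ge0.
- by apply: le_trans (uf n); case: (u n) => a b /=.
Qed.

End complex_series.

Section ell2_space.
Variable R : realType.
Implicit Types (a : R[i]).

Definition square_summable : {pred nat -> R[i]} :=
  [pred x : nat -> R[i] | `[< cvgn (series (fun n => normc (x n) ^+ 2)) >]].

Lemma square_summableP x :
  reflect (cvgn (series (fun n => normc (x n) ^+ 2))) (x \in square_summable).
Proof. by rewrite inE /=; apply: asboolP. Qed.

Lemma normc_ge0 a : 0 <= normc a.
Proof. by case: a => ? ?; apply: sqrtr_ge0. Qed.

Lemma normc_sqrD a b :
  normc (a + b) ^+ 2 <= 2 * (normc a ^+ 2) + 2 * (normc b ^+ 2).
Proof.
have h := le_normcD a b; have := normc_ge0 (a + b).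
have := sqr_ge0 (normc a - normc b).
have := normc_ge0 a; have := normc_ge0 b; move: h.
by move: (normc _) (normc _) (normc _) => x y z; nra.
Qed.

Lemma square_summable_le (x : nat -> R[i]) (f : nat -> R) :
  (forall n, normc (x n) ^+ 2 <= f n) -> cvgn (series f) ->
  x \in square_summable.
Proof.
move=> xf cf; apply/square_summableP; apply: series_le_cvg cf => // n.
  exact: sqr_ge0.
exact: le_trans (sqr_ge0 _) (xf n).
Qed.

Fact square_summable_submod_closed : submod_closed square_summable.
Proof.
split=> [|a x y /square_summableP cx /square_summableP cy].
  apply: (@square_summable_le _ 0) => [n|]; first by rewrite normc0 expr0n.
  rewrite [X in cvgn X](_ : _ = fun=> 0); first exact: is_cvg_cst.
  by apply/funext => n; rewrite /series /= big1.
apply: (@square_summable_le _ ((2 * normc a ^+ 2) *: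
    (fun n => normc (x n) ^+ 2) + 2 *: (fun n => normc (y n) ^+ 2))).
  move=> n; rewrite fctE /=; apply: le_trans (normc_sqrD _ _) _.
  by rewrite normcM exprMn mulrA.
by apply: is_cvg_seriesD; apply: is_cvg_seriesZ.
Qed.

HB.instance Definition _ := GRing.isSubmodClosed.Build R[i] (nat -> R[i])
  square_summable square_summable_submod_closed.

(* Sequences are indexed from 0: x n is the coordinate usually written x_(n+1),
   and likewise for the weights of weighted_shift. *)
Record ell2 := Ell2 {
  ell2_val :> nat -> R[i];
  ell2_valP : ell2_val \in square_summable }.

HB.instance Definition _ := [isSub for ell2_val].
HB.instance Definition _ := [Choice of ell2 by <:].
HB.instance Definition _ := [SubChoice_isSubLmodule of ell2 by <:].

Implicit Types x y z : ell2.

Lemma ell2P x y : (forall n, x n = y n) -> x = y.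
Proof. by move=> xy; apply: val_inj; apply/funext. Qed.

Lemma ell2_cvg x : cvgn (series (fun n => normc (x n) ^+ 2)).
Proof. exact/square_summableP/ell2_valP. Qed.

Definition ell2_dot x y : R[i] := csum (fun n => x n * (y n)^*).

Lemma normc_conj a : normc a^* = normc a.
Proof. by case: a => a b /=; rewrite sqrrN. Qed.

Lemma ell2_dot_summable x y : csummable (fun n => x n * (y n)^*).
Proof.
apply: (@csummable_le _ _ ((fun n => normc (x n) ^+ 2) +
    (fun n => normc (y n) ^+ 2))).
  move=> n; rewrite fctE normcM normc_conj.
  have := sqr_ge0 (normc (x n) - normc (y n)).
  have := sqr_ge0 (normc (x n) + normc (y n)); nra.
by apply: is_cvg_seriesD; apply: ell2_cvg.
Qed.

Lemma ell2_dotC x y : ell2_dot x y = (ell2_dot y x)^*.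
Proof.
rewrite /ell2_dot -csum_conj; last exact: ell2_dot_summable.
by congr csum; apply/funext => n; rewrite [RHS]rmorphM /= conjCK mulrC.
Qed.

Lemma ell2_dot_linear y : linear_for *%R (ell2_dot^~ y).
Proof.
move=> a u v; rewrite /ell2_dot.
rewrite -csumZ; last exact: ell2_dot_summable.
rewrite -csumD; last 2 first.
- exact/csummableZ/ell2_dot_summable.
- exact: ell2_dot_summable.
by congr csum; apply/funext => n; rewrite mulrDl mulrA.
Qed.

Lemma ell2_dot_bilinear :
  bilinear_for *%R (Num.conj \; *%R : R[i] -> R[i] -> R[i]) ell2_dot.
Proof.
split=> [y|x]; first exact: ell2_dot_linear.
move=> a u v; rewrite ell2_dotC ell2_dot_linear [LHS]rmorphD rmorphM /=.
by rewrite -!ell2_dotC.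
Qed.

Lemma ell2_dotxx x :
  ell2_dot x x = (limn (series (fun n => normc (x n) ^+ 2)))%:C%C.
Proof.
rewrite /ell2_dot /csum; congr Complex.
  congr (limn (series _)); apply/funext => n; case: (x n) => a b /=.
  by rewrite sqr_sqrtr ?addr_ge0 ?sqr_ge0// mulrN opprK !expr2.
rewrite [X in limn X](_ : _ = fun=> 0); first exact: lim_cst.
apply/funext => n; rewrite /series /= big1// => i _; case: (x i) => a b /=.
by rewrite mulrN mulrC addNr.
Qed.

Lemma ell2_ge_coord x n :
  normc (x n) ^+ 2 <= limn (series (fun n => normc (x n) ^+ 2)).
Proof.
apply: (@le_trans _ _ (series (fun n => normc (x n) ^+ 2) n.+1)).
  rewrite /series /= big_nat_recr//= lerDr; apply: sumr_ge0 => i _.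
  exact: sqr_ge0.
apply: nondecreasing_cvgn_le; last exact: ell2_cvg.
by apply: nondecreasing_series => i _ _; exact: sqr_ge0.
Qed.

Lemma ell2_dot_gt0 x : x != 0 -> 0 < ell2_dot x x.
Proof.
move=> x0; rewrite ell2_dotxx ltcR.
have [n xn0] : exists n, x n != 0.
  apply: contrapT => /forallNP xn0; move/eqP: x0; apply; apply: ell2P => n.
  by apply/eqP; rewrite -[_ == _]negbK; apply/negP; exact: xn0.
apply: lt_le_trans (ell2_ge_coord x n).
rewrite exprn_gt0// lt_neqAle normc_ge0 andbT eq_sym.
by apply: contra xn0 => /eqP/eq0_normc ->.
Qed.

HB.instance Definition _ := bilinear_isBilinear.Build R[i] ell2 ell2 R[i]
  *%R (Num.conj \; *%R : R[i] -> R[i] -> R[i]) ell2_dot ell2_dot_bilinear.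

Fact ell2_dot_herm x y : ell2_dot x y = (-1) ^+ false * (ell2_dot y x)^*.
Proof. by rewrite mul1r -ell2_dotC. Qed.

HB.instance Definition _ := isHermitianSesquilinear.Build R[i] ell2 false
  Num.conj ell2_dot ell2_dot_herm.
HB.instance Definition _ := isDotProduct.Build R[i] ell2 ell2_dot ell2_dot_gt0.


Local Notation "''[' u , v ]" := (ell2_dot u v) : ring_scope.
Local Notation "''[' u ]" := (ell2_dot u u) : ring_scope.

Lemma ell2_Cauchy_Schwarz x y : `|'[x, y]| ^+ 2 <= '[x] * '[y].
Proof.
have [->|y0] := eqVneq y 0.
  by rewrite !linear0r normr0 expr0n.
have yy0 : 0 < '[y] by rewrite dnorm_gt0.
have yyr : ('[y])^* = '[y] by rewrite -ell2_dotC.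
have := dnorm_ge0 ell2_dot ('[y] *: x - '[x, y] *: y).
rewrite dnormB /= !dnormZ !linearZl_LR /= !linearZr_LR /=.
rewrite (ger0_norm (ltW yy0)) !rmorphM /= conjCK yyr.
rewrite -normCKC (_ : _ - _ = '[y] * ('[x] * '[y] - `|'[x, y]| ^+ 2)).
  by rewrite pmulr_rge0// subr_ge0.
by rewrite normCKC; ring.
Qed.

Definition ell2_norm x : R[i] := sqrtC '[x].

Fact ell2_normD x y : ell2_norm (x + y) <= ell2_norm x + ell2_norm y.
Proof.
have sge0 u : 0 <= sqrtC '[u] := sqrt_dnorm_ge0 ell2_dot u.
rewrite -(@ler_pXn2r _ 2) ?nnegrE ?addr_ge0 ?sge0//.
have hd : `|'[x, y]| <= ell2_norm x * ell2_norm y.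
  rewrite -(@ler_pXn2r _ 2) ?nnegrE ?mulr_ge0 ?sge0// exprMn !sqrtCK.
  exact: ell2_Cauchy_Schwarz.
rewrite sqrrD !sqrtCK dnormD/= [leRHS]addrAC lerD2l.
rewrite (_ : _ + _ = 'Re '[x, y] *+ 2).
  by rewrite lerMn2r/= (le_trans _ hd)// (leif_Re_Creal '[x, y]).
by rewrite ReE -mulr_natr divfK ?pnatr_eq0.
Qed.

Fact ell2_normZ a x : ell2_norm (a *: x) = `|a| * ell2_norm x.
Proof.
rewrite /ell2_norm dnormZ/= rootCMl ?exprn_ge0//.
by rewrite sqrCK.
Qed.

Fact ell2_norm_eq0 x : ell2_norm x = 0 -> x = 0.
Proof. by move/eqP; rewrite sqrt_dnorm_eq0 => /eqP. Qed.

HB.instance Definition _ := Lmodule_isNormed.Build R[i] ell2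
  ell2_normD ell2_normZ ell2_norm_eq0.

End ell2_space.

Section operators.
Variable R : realType.

Section normed.
Variable V : normedModType R[i].
Implicit Types (T A B : V -> V) (M : set V).

(* The library norm of a normed module over R[i] takes (real nonnegative) values
   in R[i]; rnorm is the same number seen in R. *)
Definition rnorm (x : V) : R := complex.Re `|x|.

Definition bounded_operator T :=
  linear T /\ exists C : R, forall x, rnorm (T x) <= C * rnorm x.

Definition closed_subspace M :=
  [/\ M 0, forall (a : R[i]) x y, M x -> M y -> M (a *: x + y) & closed M].

Definition absolutely_norm_attaining T :=
  bounded_operator T /\
  forall M, closed_subspace M -> (exists2 x, M x & x != 0) ->
    let M1 := [set x | M x /\ rnorm x <= 1] in
    exists2 x0, M1 x0 & rnorm (T x0) = sup [set rnorm (T x) | x in M1].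

Definition spectrum A : set R[i] :=
  [set l | ~ exists B, [/\ bounded_operator B,
                          forall x, B (A x - l *: x) = x &
                          forall x, A (B x) - l *: B x = x]].

End normed.

Implicit Types (T S P : ell2 R -> ell2 R) (w : nat -> R[i]).

Definition is_adjoint T S :=
  forall x y, ell2_dot (T x) y = ell2_dot x (S y).

Definition positive_operator P := forall x, 0 <= ell2_dot (P x) x.

Definition is_absolute_value T P :=
  [/\ bounded_operator P, positive_operator P &
      exists2 S, is_adjoint T S & forall x, P (P x) = S (T x)].

(* |T| is the unique positive square root of T^*T; absolute_value_weighted_shift
   below shows that it exists, hence is what get selects, for the operators
   considered here. *)
Definition absolute_value T : ell2 R -> ell2 R := get (is_absolute_value T).

Definition bounded_sequence w := exists C : R, forall n, normc (w n) <= C.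

Fact diagonal_subproof w (hw : bounded_sequence w) (x : ell2 R) :
  (fun n => w n * x n) \in @square_summable R.
Proof.
have [C wC] := hw.
apply: (@square_summable_le _ _ (C ^+ 2 *: (fun n => normc (x n) ^+ 2))).
  move=> n; rewrite normcM exprMn /= ler_wpM2r ?sqr_ge0//.
  by rewrite lerXn2r ?nnegrE ?normc_ge0// (le_trans _ (wC n)) ?normc_ge0.
by apply: is_cvg_seriesZ; exact: ell2_cvg.
Qed.

Definition diagonal w (hw : bounded_sequence w) (x : ell2 R) : ell2 R :=
  Ell2 (diagonal_subproof hw x).

Lemma series_shift (f : nat -> R) : f 0%N = 0 ->
  [sequence series f n.+1]_n = series (fun n => f n.+1).
Proof.
move=> f0; apply/funext => n; rewrite /series /=.
by rewrite big_nat_recl//= f0 add0r.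
Qed.

Lemma is_cvg_series_shift (f : nat -> R) : f 0%N = 0 ->
  cvgn (series (fun n => f n.+1)) -> cvgn (series f).
Proof.
move=> f0; rewrite -series_shift// => cf.
by apply/cvg_ex; exists (limn [sequence series f n.+1]_n); rewrite -cvg_shiftS.
Qed.

Fact weighted_shift_subproof w (hw : bounded_sequence w) (x : ell2 R) :
  (fun n => if n is m.+1 then w m * x m else 0) \in @square_summable R.
Proof.
apply/square_summableP; apply: is_cvg_series_shift => /=.
  by rewrite expr0n/= addr0 sqrtr0 expr0n.
exact: (@ell2_cvg R (diagonal hw x)).
Qed.

Definition weighted_shift w (hw : bounded_sequence w) (x : ell2 R) : ell2 R :=
  Ell2 (weighted_shift_subproof hw x).


Lemma bounded_sequence_modulus w :
  bounded_sequence w -> bounded_sequence (fun n => `|w n|).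
Proof.
case=> C wC; exists C => n.
rewrite normc_def /= expr0n addr0 sqrtr_sqr ger0_norm ?sqrtr_ge0//.
by have := wC n; case: (w n).
Qed.

Lemma rnormE (x : ell2 R) :
  rnorm x = Num.sqrt (limn (series (fun n => normc (x n) ^+ 2))).
Proof.
rewrite /rnorm -[`|x|]/(sqrtC (ell2_dot x x)) ell2_dotxx.
set l := limn _; have l0 : 0 <= l.
  exact: le_trans (sqr_ge0 _) (ell2_ge_coord x 0).
by rewrite -{1}(sqr_sqrtr l0) rmorphXn /= sqrCK ?ler0c ?sqrtr_ge0.
Qed.

Lemma bounded_operator_diagonal w (hw : bounded_sequence w) :
  bounded_operator (diagonal hw).
Proof.
split.
  by move=> a x y; apply: ell2P => n /=; rewrite mulrDr mulrCA.
have [C wC] := hw; exists C => x.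
have C0 : 0 <= C by exact: le_trans (normc_ge0 _) (wC 0%N).
rewrite !rnormE -[X in X * _]ger0_norm// -sqrtr_sqr -sqrtrM ?sqr_ge0//.
rewrite ler_wsqrtr// -[leRHS]lim_seriesZ; last exact: ell2_cvg.
apply: lim_series_le => [||n]; first exact: (@ell2_cvg R (diagonal hw x)).
  by apply: is_cvg_seriesZ; exact: ell2_cvg.
rewrite /= normcM exprMn ler_wpM2r ?sqr_ge0//.
by rewrite lerXn2r ?nnegrE ?normc_ge0.
Qed.

Lemma csum_shift (u : nat -> R[i]) : u 0%N = 0 ->
  csummable (fun n => u n.+1) -> csum u = csum (fun n => u n.+1).
Proof.
move=> u0 [cr ci]; rewrite /csum; congr Complex.
  apply/cvg_lim => //; rewrite -cvg_shiftS.
  by rewrite (@series_shift (fun n => complex.Re (u n))) ?u0.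
apply/cvg_lim => //; rewrite -cvg_shiftS.
by rewrite (@series_shift (fun n => complex.Im (u n))) ?u0.
Qed.

Fact backward_shift_subproof w (hw : bounded_sequence w) (x : ell2 R) :
  (fun n => (w n)^* * x n.+1) \in @square_summable R.
Proof.
have [C wC] := hw.
apply: (@square_summable_le _ _ (C ^+ 2 *: (fun n => normc (x n.+1) ^+ 2))).
  move=> n; rewrite normcM normc_conj exprMn /= ler_wpM2r ?sqr_ge0//.
  by rewrite lerXn2r ?nnegrE ?normc_ge0// (le_trans _ (wC n)) ?normc_ge0.
apply: is_cvg_seriesZ.
have sE : series (fun n => normc (x n.+1) ^+ 2) =
    [sequence series (fun n => normc (x n) ^+ 2) n.+1]_n - cst (normc (x 0) ^+ 2).
  apply/funext => n; rewrite /series /= !fctE /= [in RHS]big_nat_recl//= /bump.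
  by rewrite addrC addKr.
rewrite sE; apply: is_cvgB; last exact: is_cvg_cst.
apply/cvg_ex; exists (limn (series (fun n => normc (x n) ^+ 2))).
by rewrite cvg_shiftS; exact: ell2_cvg.
Qed.

Lemma csum_ge0 (u : nat -> R[i]) :
  csummable u -> (forall n, 0 <= u n) -> 0 <= csum u.
Proof.
move=> [cr ci] u0; rewrite lecE /=; apply/andP; split.
  rewrite [X in limn X](_ : _ = fun=> 0) ?lim_cst//.
  apply/funext => n; rewrite /series /= big1// => i _.
  by have := u0 i; rewrite lecE => /andP[/eqP].
apply: limr_ge => //; near=> n; apply: sumr_ge0 => i _.
by have := u0 i; rewrite lecE => /andP[].
Unshelve. all: by end_near.
Qed.

Lemma absolute_value_weighted_shift w (hw : bounded_sequence w) :
  is_absolute_value (weighted_shift hw) (absolute_value (weighted_shift hw)).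
Proof.
apply: getPex; exists (diagonal (bounded_sequence_modulus hw)); split.
- exact: bounded_operator_diagonal.
- move=> x; apply: csum_ge0 => [|n]; first exact: ell2_dot_summable.
  by rewrite /= -mulrA mulr_ge0// mul_conjC_ge0.
- exists (fun x => Ell2 (backward_shift_subproof hw x)).
    move=> x y; have uE : (fun n => (weighted_shift hw x) n.+1 * (y n.+1)^*) =
        (fun n => x n * ((w n)^* * y n.+1)^*).
      by apply/funext => n /=; rewrite rmorphM /= conjCK mulrA (mulrC (x n)).
    rewrite /ell2_dot csum_shift ?mul0r// uE//.
    exact: (@ell2_dot_summable R x (Ell2 (backward_shift_subproof hw y))).
  move=> x; apply: ell2P => n /=.
  by rewrite mulrA -expr2 normCKC mulrA.
Qed.

End operators.

(* Main.v *)
Require Import Defs.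
From mathcomp Require Import all_boot all_order all_algebra.
From mathcomp Require Import all_classical all_reals all_analysis.
From mathcomp Require Import complex.
From mathcomp Require Import ring lra.

Import Order.TTheory GRing.Theory Num.Theory.
Import numFieldNormedType.Exports.
Import ComplexField.Normc.

Local Open Scope classical_set_scope.
Local Open Scope ring_scope.

Set Implicit Arguments.
Unset Strict Implicit.
Unset Printing Implicit Defensive.

(** Write [a n] for the modulus of [w n].  Since the squared norm of [T x] is the
    sum of [a n ^+ 2 * normc (x n) ^+ 2], only the diagonal operator [|T|] matters.
    Both alternatives of the theorem say the same thing about [a], namely
    [cvg_from_above a alpha]: [a] converges to [alpha], and [a n >= alpha] from some
    index on.  The first alternative is the case where [a] takes infinitely many
    values, the second the case where it takes finitely many.

    Sufficiency ([absolutely_norm_attaining_of_cvg]).  Let [s] be the norm of [T]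
    restricted to the closed subspace [M].  The defect [s^2 |z|^2 - |T z|^2] is a
    nonnegative quadratic form on [M], so by the parallelogram law it is small on
    the difference of two almost maximizing unit vectors.  If the defect together
    with finitely many coordinates controls the norm of [M], almost maximizing
    vectors whose coordinates converge are therefore Cauchy, and their limit attains
    [s] ([attained_of_coercive]).  The control is immediate if [s > alpha], because
    [a n] stays away from [s] for large [n].  If [s <= alpha], let [N] be such that
    [a n >= alpha] for [n >= N]: a nonzero vector of [M] whose first [N] coordinates
    vanish attains [s] at once, and if there is none then [M] is finite-dimensional
    and its norm is controlled by these coordinates alone ([coord_bound_of_inj]).

    Necessity ([cvg_of_absolutely_norm_attaining]).  If [a n <= b] infinitely often
    and [a n >= c] infinitely often, with [b < c], then unit vectors in the planes
    spanned by a low and a high basis vector can be chosen with images of any norm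
    between [b] and [c]; a sequence of such vectors whose norms increase strictly to
    [c] spans a closed subspace on which [c] is approached but not attained
    ([not_attaining_of_two_levels]).  So [a] converges to some [alpha].  If
    [a n < alpha] infinitely often, the corresponding basis vectors span such a
    subspace too ([not_attaining_of_low_moduli]).

    The second alternative mentions the spectrum of [|T|]; the positive square root
    of [T^* T] is identified with the diagonal operator of the moduli
    ([absolute_value_weighted_shiftE]), and the spectrum of a diagonal operator with
    finitely many distinct entries is the set of these entries. *)

(** * Weighted sums of squared coordinates *)

Section Energy.
Variable R : realType.
Implicit Types (c d : nat -> R) (x y z : ell2 R) (M : set (ell2 R)).

Definition bounded_weight c := exists C : R, forall n, `|c n| <= C.

(** The quadratic form of the diagonal operator with real entries [c]; the squared
    norms of [x] and [T x] and all defects compared below are of this kind, which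
    reduces inequalities between them to inequalities between weights. *)
Definition energy c x : R := limn (series (fun n => c n * normc (x n) ^+ 2)).

Lemma energy_cvg c x : bounded_weight c ->
  cvgn (series (fun n => c n * normc (x n) ^+ 2)).
Proof.
move=> [C cC]; apply: normed_cvg.
have C0 : 0 <= C := le_trans (normr_ge0 _) (cC 0%N).
apply: (@series_le_cvg _ _ (C *: (fun n => normc (x n) ^+ 2))) => [n|n|n|].
- exact: normr_ge0.
- by rewrite fctE mulr_ge0// sqr_ge0.
- by rewrite fctE /= normrM (ger0_norm (sqr_ge0 _)) ler_wpM2r ?sqr_ge0.
- by apply: is_cvg_seriesZ; exact: ell2_cvg.
Qed.

Lemma bounded_weight_cst (r : R) : bounded_weight (fun=> r).
Proof. by exists `|r|. Qed.

Lemma bounded_weightB c d :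
  bounded_weight c -> bounded_weight d -> bounded_weight (fun n => c n - d n).
Proof.
move=> [C cC] [D dD]; exists (C + D) => n.
by rewrite (le_trans (ler_normB _ _))// lerD.
Qed.

Lemma energyB c d x : bounded_weight c -> bounded_weight d ->
  energy (fun n => c n - d n) x = energy c x - energy d x.
Proof.
move=> bc bd; rewrite /energy -lim_seriesB; try exact: energy_cvg.
by congr (limn (series _)); apply/funext => n; rewrite !fctE /= mulrBl.
Qed.

Lemma energy_le c d x : bounded_weight c -> bounded_weight d ->
  (forall n, c n * normc (x n) ^+ 2 <= d n * normc (x n) ^+ 2) ->
  energy c x <= energy d x.
Proof. by move=> bc bd cd; apply: lim_series_le => //; exact: energy_cvg. Qed.

Lemma energy_cst (r : R) x : energy (fun=> r) x = r * rnorm x ^+ 2.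
Proof.
rewrite rnormE sqr_sqrtr; last exact: le_trans (sqr_ge0 _) (ell2_ge_coord x 0).
rewrite -[RHS]/(r *: _) -lim_seriesZ; last exact: ell2_cvg.
by congr (limn (series _)); apply/funext => n; rewrite !fctE.
Qed.

Lemma energy_ge_coord c x n : bounded_weight c ->
  (forall k, 0 <= c k * normc (x k) ^+ 2) -> c n * normc (x n) ^+ 2 <= energy c x.
Proof.
move=> bc c0.
apply: (@le_trans _ _ (series (fun n => c n * normc (x n) ^+ 2) n.+1)).
  by rewrite /series /= big_nat_recr//= lerDr; apply: sumr_ge0 => i _.
apply: nondecreasing_cvgn_le; last exact: energy_cvg.
by apply: nondecreasing_series => i _ _.
Qed.

Lemma energy_initial (N : nat) x :
  energy (fun n => (n < N)%N%:R) x = \sum_(0 <= n < N) normc (x n) ^+ 2.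
Proof.
apply/cvg_lim => //; rewrite -(cvg_shiftn N) /=; apply: cvg_near_cst.
near=> k; rewrite /series /= (@big_cat_nat _ _ _ N) ?leq_addl//=.
rewrite [X in _ + X](_ : _ = 0).
  by rewrite addr0; apply: eq_big_nat => i /andP[_ ->]; rewrite mul1r.
by rewrite big_nat big1// => i /andP[Ni _]; rewrite ltnNge Ni mul0r.
Unshelve. all: by end_near.
Qed.

Lemma bounded_weight_initial (N : nat) :
  bounded_weight (fun n => (n < N)%N%:R).
Proof. by exists 1 => n; case: (n < N)%N; rewrite ?normr1 ?normr0. Qed.

Lemma bounded_weightZ (r : R) c : bounded_weight c -> bounded_weight (fun n => r * c n).
Proof. by move=> [C cC]; exists (`|r| * C) => n; rewrite normrM ler_wpM2l. Qed.

Lemma energyZ (r : R) c x : bounded_weight c ->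
  energy (fun n => r * c n) x = r * energy c x.
Proof.
move=> bc; rewrite /energy -[RHS]/(r *: _) -lim_seriesZ; last exact: energy_cvg.
by congr (limn (series _)); apply/funext => n; rewrite !fctE -mulrA.
Qed.

(** * The norm of [ell2] as a real number *)

Lemma normc_sqr_gt0 (b : R[i]) : b != 0 -> 0 < normc b ^+ 2.
Proof.
by move=> b0; rewrite exprn_gt0// lt_def normc_ge0 andbT; apply: contra b0 => /eqP/eq0_normc->.
Qed.

Lemma ell2_neq0P x : x != 0 -> exists n, x n != 0.
Proof.
move=> /eqP x0; apply: contrapT => /forallNP xz; apply: x0; apply: ell2P => n.
by apply/eqP; rewrite -[_ == _]negbK; apply/negP; exact: xz.
Qed.

Lemma normE_rnorm x : `|x| = (rnorm x)%:C%C.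
Proof.
rewrite /rnorm; have : 0 <= `|x| := normr_ge0 x.
by case: (`|x|) => a b; rewrite lecE /= => /andP[/eqP-> _].
Qed.

Lemma rnorm_ge0 x : 0 <= rnorm x.
Proof. by rewrite -lecR -normE_rnorm; exact: normr_ge0. Qed.

Lemma rnormD x y : rnorm (x + y) <= rnorm x + rnorm y.
Proof. by rewrite -lecR rmorphD /= -!normE_rnorm ler_normD. Qed.

Lemma rnormN x : rnorm (- x) = rnorm x.
Proof. by rewrite /rnorm normrN. Qed.

Lemma rnormZ (a : R[i]) x : rnorm (a *: x) = normc a * rnorm x.
Proof.
by apply: complexI; rewrite rmorphM /= -!normE_rnorm normrZ.
Qed.

Lemma rnorm0 : rnorm (0 : ell2 R) = 0.
Proof. by rewrite /rnorm normr0. Qed.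

Lemma rnorm_gt0 x : x != 0 -> 0 < rnorm x.
Proof. by move=> x0; rewrite -ltcR -normE_rnorm normr_gt0. Qed.

Lemma linear_op0 (S : ell2 R -> ell2 R) : linear S -> S 0 = 0.
Proof. by move=> Slin; have := Slin (-1) 0 0; rewrite scaler0 addr0 scaleN1r addNr. Qed.

Lemma linear_opD (S : ell2 R -> ell2 R) x y : linear S -> S (x + y) = S x + S y.
Proof. by move=> Slin; rewrite -[x in LHS]scale1r Slin scale1r. Qed.

Lemma linear_opZ (S : ell2 R -> ell2 R) (b : R[i]) x : linear S -> S (b *: x) = b *: S x.
Proof. by move=> Slin; rewrite -[b *: x in LHS]addr0 Slin linear_op0// addr0. Qed.

Lemma rnorm_sqr x : rnorm x ^+ 2 = energy (fun=> 1) x.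
Proof. by rewrite energy_cst mul1r. Qed.

Lemma ell2_parallelogram x y :
  rnorm (x + y) ^+ 2 + rnorm (x - y) ^+ 2 = 2 * (rnorm x ^+ 2 + rnorm y ^+ 2).
Proof.
have sqrE z : rnorm z ^+ 2 = limn (series (fun n => normc (z n) ^+ 2)).
  rewrite rnorm_sqr /energy; congr (limn (series _)).
  by apply/funext => n; rewrite mul1r.
rewrite !sqrE -!lim_seriesD; try exact: ell2_cvg.
rewrite -[RHS]/(2 *: _) -lim_seriesZ; last by apply: is_cvg_seriesD; exact: ell2_cvg.
congr (limn (series _)); apply/funext => n; rewrite !fctE /=.
rewrite -[LHS]/(normc (x n + y n) ^+ 2 + normc (x n - y n) ^+ 2).
case: (x n) (y n) => [a b] [c d] /=.
by rewrite !sqr_sqrtr ?addr_ge0 ?sqr_ge0// /GRing.scale /=; ring.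
Qed.

Lemma coord_le_rnorm x n : normc (x n) <= rnorm x.
Proof.
rewrite -(@ler_pXn2r _ 2) ?nnegrE ?rnorm_ge0 ?normc_ge0// rnorm_sqr.
rewrite -[leLHS]mul1r; apply: (@energy_ge_coord (fun=> 1)).
  exact: bounded_weight_cst.
by move=> k; rewrite mul1r sqr_ge0.
Qed.

Lemma sum_coord_le_rnorm (N : nat) x :
  \sum_(0 <= n < N) normc (x n) ^+ 2 <= rnorm x ^+ 2.
Proof.
rewrite -energy_initial rnorm_sqr; apply: energy_le => [||n].
- exact: bounded_weight_initial.
- exact: bounded_weight_cst.
- by rewrite ler_wpM2r ?sqr_ge0//; case: ltnP.
Qed.

Lemma rnorm_le_sum x (r : R) : 0 <= r ->
  (forall N, \sum_(0 <= n < N) normc (x n) ^+ 2 <= r ^+ 2) -> rnorm x <= r.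
Proof.
move=> r0 le_r; rewrite -(@ler_pXn2r _ 2) ?nnegrE ?rnorm_ge0// rnorm_sqr.
apply: limr_le; first exact/energy_cvg/bounded_weight_cst.
apply: nearW => N; apply: le_trans (le_r N).
by rewrite /series /=; under eq_bigr do rewrite mul1r.
Qed.

(** Balls of [ell2 R] have their radii in [R[i]]; this removes them from all
    later topological arguments. *)
Lemma closed_rnormP M :
  closed M <-> forall x, (forall e : R, 0 < e -> exists2 y, M y & rnorm (y - x) < e) -> M x.
Proof.
split=> [cM x xM|cM x xM].
  apply: cM => B /nbhs_ballP[e /= e0 eB].
  have e_re : e = (complex.Re e)%:C%C.
    by move: e0; case: (e) => a b; rewrite ltcE /= => /andP[/eqP->].
  have [|y My yx] := xM (complex.Re e); first by rewrite -ltcR -e_re.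
  exists y; split=> //; apply: eB; rewrite -ball_normE /= distrC.
  by rewrite normE_rnorm e_re ltcR.
apply: cM => e e0; have [|y [My]] := xM (ball x e%:C%C).
  by apply: nbhsx_ballx; rewrite ltcR.
by rewrite -ball_normE /= distrC normE_rnorm ltcR => yx; exists y.
Qed.

End Energy.

(** * Attainment of the norm on a subspace where the defect is coercive *)

Section Attainment.
Variable R : realType.
Implicit Types (x y z : ell2 R) (M : set (ell2 R)) (T : ell2 R -> ell2 R).

(** An ultrafilter replaces the diagonal extraction of a subsequence along which all
    coordinates converge. *)
Lemma ultra_bounded_limit (X : Type) (U : set_system X) (f : X -> R) (C : R) :
  UltraFilter U -> U [set t | `|f t| <= C] ->
  exists l, forall e, 0 < e -> U [set t | `|f t - l| < e].
Proof.
move=> UU fC; have fU : (f @ U) `[- C, C]%classic.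
  rewrite /fmap /=; apply: (filterS _ fC) => t /=.
  by rewrite in_itv /= -ler_norml.
have [l [_ lU]] := @segment_compact R (- C) C _ _ fU.
exists l => e e0.
have [//|nU] := in_ultra_setVsetC [set t | `|f t - l| < e] UU.
have [|y [fy]] := lU [set r | ~ `|r - l| < e] (ball l e) nU.
  exact: nbhsx_ballx.
by rewrite -ball_normE /= distrC.
Qed.

Section FilterLimit.
Variables (F : set_system (ell2 R)) (xi : nat -> R[i]).
Hypothesis FF : ProperFilter F.
Hypothesis coord_xi :
  forall n e, 0 < e -> F [set z | normc (z n - xi n) ^+ 2 < e].

Lemma filter_sum_coord (N : nat) (e : R) : 0 < e ->
  F [set z | \sum_(0 <= n < N) normc (z n - xi n) ^+ 2 < e].
Proof.
elim: N e => [|N IH] e e0.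
  by apply: filterE => z /=; rewrite big_geq.
have e2 : 0 < e / 2 by rewrite divr_gt0.
apply: filterS (filterI (IH _ e2) (coord_xi N e2)) => z /= [zN zn].
by rewrite big_nat_recr//= (splitr e) ltrD.
Qed.

(** Completeness, in the form where the coordinatewise limit [xi] is already known:
    the partial sums of [y - xi], for [y] in a small set [A] of the filter, are
    compared with those of [y - z], where [z] in [A] is close to [xi] on the
    finitely many coordinates involved. *)
Lemma ell2_complete :
  (forall e, 0 < e ->
     exists2 A, F A & forall y z, A y -> A z -> rnorm (y - z) <= e) ->
  exists x, forall e, 0 < e -> F [set z | rnorm (z - x) <= e].
Proof.
move=> cauchyF.
have near_xi e A : 0 < e -> F A ->
    (forall y z, A y -> A z -> rnorm (y - z) <= e) -> forall y, A y -> forall N,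
    \sum_(0 <= n < N) normc (y n - xi n) ^+ 2 <= (2 * e) ^+ 2.
  move=> e0 FA Ae y Ay N.
  have [z [Az zN]] := filter_ex (filterI FA (filter_sum_coord N (exprn_gt0 2 e0))).
  apply: (@le_trans _ _ (2 * \sum_(0 <= n < N) normc ((y - z) n) ^+ 2 +
                         2 * \sum_(0 <= n < N) normc (z n - xi n) ^+ 2)).
    rewrite !mulr_sumr -big_split /=; apply: ler_sum => n _.
    rewrite -[normc ((y - z) n)]/(normc (y n - z n)).
    by rewrite -[y n - xi n](subrKA (z n)); exact: normc_sqrD.
  have := sum_coord_le_rnorm N (y - z); have := Ae _ _ Ay Az.
  by have := rnorm_ge0 (y - z); move: zN => /=; nra.
have [A FA A1] := cauchyF 1 ltr01.
have [y Ay] := filter_ex FA.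
have sq : (fun n => y n - xi n) \in @square_summable R.
  apply/square_summableP; apply: nondecreasing_is_cvgn.
    by apply: nondecreasing_series => i _ _; exact: sqr_ge0.
  by exists ((2 * 1) ^+ 2) => _ [N _ <-]; exact: (near_xi _ _ ltr01 FA A1).
(* [y - Ell2 sq] has coordinates [xi n], now known to be square summable. *)
exists (y - Ell2 sq) => e e0.
have [B FB Be] := cauchyF (e / 2) (divr_gt0 e0 (ltr0Sn _ _)).
apply: (filterS _ FB) => z Bz /=; apply: (rnorm_le_sum (ltW e0)) => N.
have -> : e = 2 * (e / 2) by field.
rewrite (_ : \sum_(0 <= n < N) _ = \sum_(0 <= n < N) normc (z n - xi n) ^+ 2).
  exact: (near_xi _ _ (divr_gt0 e0 (ltr0Sn _ _)) FB Be).
apply: eq_bigr => n _; congr (normc _ ^+ 2).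
by rewrite -[LHS]/(z n - (y n - (y n - xi n))) subKr.
Qed.

End FilterLimit.

Lemma ultra_coord_limit (U : set_system (ell2 R)) :
  UltraFilter U -> U [set z | rnorm z <= 1] -> exists xi : nat -> R[i],
  forall n e, 0 < e -> U [set z | normc (z n - xi n) ^+ 2 < e].
Proof.
move=> UU U1; suff /choice[xi Uxi] : forall n, exists l : R[i], forall e, 0 < e ->
    U [set z : ell2 R | normc (z n - l) ^+ 2 < e] by exists xi.
move=> n; have sqr_le1 (a b : R) : Num.sqrt (a ^+ 2 + b ^+ 2) <= 1 ->
    `|a| <= 1 /\ `|b| <= 1.
  move=> ab; split; apply: le_trans ab; rewrite -sqrtr_sqr ler_wsqrtr//.
    by rewrite lerDl sqr_ge0.
  by rewrite lerDr sqr_ge0.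
have coord1 (z : ell2 R) : rnorm z <= 1 ->
    `|complex.Re (z n)| <= 1 /\ `|complex.Im (z n)| <= 1.
  move=> z1; apply: sqr_le1; apply: le_trans (le_trans (coord_le_rnorm z n) z1).
  by case: (z n).
have [|a aU] := @ultra_bounded_limit _ U (fun z => complex.Re (z n)) 1 UU.
  by apply: (filterS _ U1) => z /coord1[].
have [|b bU] := @ultra_bounded_limit _ U (fun z => complex.Im (z n)) 1 UU.
  by apply: (filterS _ U1) => z /coord1[].
exists (Complex a b) => e e0; have r0 : 0 < Num.sqrt (e / 2) by rewrite sqrtr_gt0 divr_gt0.
apply: filterS (filterI (aU _ r0) (bU _ r0)) => z /= [].
case: (z n) => c d /= ca db; rewrite sqr_sqrtr ?addr_ge0 ?sqr_ge0//.
rewrite (splitr e) -[e / 2]sqr_sqrtr; last by rewrite divr_ge0 ?(ltW e0).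
by rewrite -(real_normK (num_real (c - a))) -(real_normK (num_real (d - b)))
  ltrD// ltrXn2r// nnegrE.
Qed.

(** Along an ultrafilter of vectors of [M] that nearly attain [s], the coordinates
    converge and the defect [s^2 |z|^2 - |T z|^2] tends to zero.  It is nonnegative
    on sums of vectors of [M], so the parallelogram law makes it small on their
    differences; by coercivity the ultrafilter is Cauchy, and its limit lies in the
    closed set [M]. *)
Lemma attained_of_coercive T M (s C : R) (N : nat) :
  bounded_operator T -> closed_subspace M -> 0 <= s -> 0 <= C ->
  (forall z, M z -> rnorm (T z) <= s * rnorm z) ->
  (forall e, 0 < e -> exists z, [/\ M z, rnorm z <= 1 & s - e < rnorm (T z)]) ->
  (forall z, M z -> rnorm z ^+ 2 <=
     C * (\sum_(0 <= n < N) normc (z n) ^+ 2 +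
          (s ^+ 2 * rnorm z ^+ 2 - rnorm (T z) ^+ 2))) ->
  exists x, [/\ M x, rnorm x <= 1 & s <= rnorm (T x)].
Proof.
move=> [Tlin [K TK]] [M0 Mlin Mcl] s0 C0 Ts smax coer.
have MD y z : M y -> M z -> M (y + z).
  by move=> My Mz; rewrite -[y]scale1r; exact: Mlin.
have MB y z : M y -> M z -> M (y - z).
  by move=> My Mz; rewrite addrC -scaleN1r; exact: Mlin.
have TD y z : T (y + z) = T y + T z by exact: linear_opD.
have TB y z : T (y - z) = T y - T z.
  by rewrite addrC -scaleN1r Tlin scaleN1r addrC.
pose E e := [set z | [/\ M z, rnorm z <= 1 & s - e < rnorm (T z)]].
have EF : ProperFilter (filter_from [set e : R | 0 < e] E).
  apply: filter_from_proper; last by move=> e e0; exact: smax.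
  apply: filter_from_filter; first by exists 1; exact: ltr01.
  move=> d e /= d0 e0; exists (Num.min d e); first by rewrite lt_min d0.
  by move=> z [Mz z1 Tz]; split; split=> //; apply: le_lt_trans Tz;
    rewrite lerD2l lerN2 ge_min lexx ?orbT.
have [U [UU EU]] := ultraFilterLemma EF.
have UE e : 0 < e -> U (E e) by move=> e0; apply: EU; exists e.
have [|xi Uxi] := @ultra_coord_limit U UU.
  by apply: filterS (UE 1 ltr01) => z [].
have [|x Ux] := @ell2_complete U xi _ Uxi.
  (* On [E eta] each defect is at most [2 * s * eta], so that of a difference is at
     most [8 * s * eta]; the first [N] coordinates contribute [4 * eta]. *)
  move=> e e0; pose eta := e ^+ 2 / (C * (4 + 8 * s) + 1).
  have den0 : 0 < C * (4 + 8 * s) + 1 by nra.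
  have eta0 : 0 < eta by rewrite divr_gt0 ?exprn_gt0.
  exists (E eta `&` [set z | \sum_(0 <= n < N) normc (z n - xi n) ^+ 2 < eta]).
    by apply: filterI (UE _ eta0) _; exact: filter_sum_coord.
  move=> y z [[My y1 Ty] yN] [[Mz z1 Tz] zN].
  rewrite -(@ler_pXn2r _ 2) ?nnegrE ?rnorm_ge0 ?(ltW e0)//.
  apply: le_trans (coer _ (MB _ _ My Mz)) _.
  have -> : e ^+ 2 = eta * (C * (4 + 8 * s) + 1) by rewrite divfK ?gt_eqF.
  have defect u : E eta u -> s ^+ 2 * rnorm u ^+ 2 - rnorm (T u) ^+ 2 <= 2 * s * eta.
    move=> [Mu u1 Tu]; have := Ts _ Mu; have := rnorm_ge0 u; have := rnorm_ge0 (T u).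
    move: (rnorm u) (rnorm (T u)) u1 Tu => r t r1 st t0 r0 tsr.
    have sr : s * r <= s by rewrite ler_piMr.
    have sr2 : (s * r) ^+ 2 <= s ^+ 2 by rewrite lerXn2r ?nnegrE ?mulr_ge0.
    have : 0 <= (eta - (s - t)) * (s + t) by apply: mulr_ge0; lra.
    have : 0 <= eta * (s - t) by apply: mulr_ge0; lra.
    rewrite exprMn in sr2; nra.
  have sumyz : \sum_(0 <= n < N) normc ((y - z) n) ^+ 2 <= 4 * eta.
    apply: (@le_trans _ _ (2 * \sum_(0 <= n < N) normc (y n - xi n) ^+ 2 +
                           2 * \sum_(0 <= n < N) normc (z n - xi n) ^+ 2)).
      rewrite !mulr_sumr -big_split /=; apply: ler_sum => n _.
      rewrite -[normc ((y - z) n)]/(normc (y n - z n)).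
      rewrite -[y n - z n](subrKA (xi n)).
      have -> : normc (z n - xi n) = normc (xi n - z n) by rewrite -normcN opprB.
      exact: normc_sqrD.
    by move: yN zN => /=; lra.
  have dyz : s ^+ 2 * rnorm (y - z) ^+ 2 - rnorm (T (y - z)) ^+ 2 <= 8 * s * eta.
    have Tge := Ts _ (MD _ _ My Mz); rewrite TD in Tge; rewrite TB.
    have := ell2_parallelogram y z; have := ell2_parallelogram (T y) (T z).
    have dy := defect y (And3 My y1 Ty); have dz := defect z (And3 Mz z1 Tz).
    have : rnorm (T y + T z) ^+ 2 <= s ^+ 2 * rnorm (y + z) ^+ 2.
      by rewrite -exprMn lerXn2r ?nnegrE ?rnorm_ge0// mulr_ge0 ?rnorm_ge0.
    move: dy dz; move: (rnorm y ^+ 2) (rnorm z ^+ 2) (rnorm (y - z) ^+ 2) => a b c.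
    move: (rnorm (y + z) ^+ 2) => d.
    move=> H1 H2 H3 H4 H5.
    have -> : c = 2 * (a + b) - d by lra.
    by lra.
  apply: (@le_trans _ _ (C * (4 * eta + 8 * s * eta))).
    by rewrite ler_wpM2l// lerD.
  by nra.
have Uz e : 0 < e -> exists z, [/\ M z, rnorm z <= 1, s - e < rnorm (T z) & rnorm (z - x) <= e].
  move=> e0; have [z [[Mz z1 Tz] zx]] := filter_ex (filterI (UE e e0) (Ux e e0)).
  by exists z.
exists x; split.
- apply: (closed_rnormP M).1 Mcl _ _ => e e0.
  have [z [Mz _ _ zx]] := Uz (e / 2) (divr_gt0 e0 (ltr0Sn _ _)).
  by exists z => //; apply: le_lt_trans zx _; lra.
- apply/ler_addgt0Pr => e e0; have [z [_ z1 _ zx]] := Uz e e0.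
  rewrite -[x](subrKC z); apply: le_trans (rnormD _ _) _.
  by rewrite lerD// -opprB rnormN.
- apply/ler_addgt0Pr => e e0.
  have d0 : 0 < e / (`|K| + 1) by rewrite divr_gt0// ltr_wpDl.
  have [z [_ _ Tz zx]] := Uz _ d0.
  have : rnorm (T z) <= rnorm (T x) + rnorm (T (z - x)).
    by rewrite TB -{1}[T z](subrKC (T x)) rnormD.
  have := TK (z - x); have := rnorm_ge0 (z - x); have := ler_norm K.
  have : e = e / (`|K| + 1) * (`|K| + 1) by rewrite divfK// gt_eqF// ltr_wpDl.
  move: (e / _) zx Tz d0 (normr_ge0 K) => d; nra.
Qed.

End Attainment.

(** * Convergence of the moduli from above suffices *)

Section Sufficiency.
Variable R : realType.
Implicit Types (x y z : ell2 R) (M : set (ell2 R)) (a : nat -> R).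

Definition cvg_from_above a (alpha : R) :=
  a @ \oo --> alpha /\ \forall n \near \oo, alpha <= a n.

(** The hypothesis makes [M] finite-dimensional.  By induction on [N] no basis of [M]
    is needed: if some [v] in [M] has [v N <> 0], subtracting a multiple of [v]
    sends [z] to the subspace of [M] where the coordinate [N] vanishes. *)
Lemma coord_bound_of_inj M (N : nat) :
  (forall (b : R[i]) x y, M x -> M y -> M (b *: x + y)) ->
  (forall z, M z -> (forall n, (n < N)%N -> z n = 0) -> z = 0) ->
  exists2 C, 0 <= C & forall z, M z ->
    rnorm z ^+ 2 <= C * \sum_(0 <= n < N) normc (z n) ^+ 2.
Proof.
elim: N M => [|N IH] M Mlin Minj.
  by exists 0 => // z Mz; rewrite (Minj z)// rnorm0 expr0n mul0r.
have [b x y [Mx xN] [My yN]|z [Mz zN] zn|C C0 CM] := IH (M `&` [set z | z N = 0]).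
- split; first exact: Mlin.
  by rewrite /= -[LHS]/(b * x N + y N) xN yN mulr0 addr0.
- by apply: Minj => // n; rewrite ltnS leq_eqVlt => /orP[/eqP->//|/zn].
have [[v [Mv /eqP vN]]|] := pselect (exists v, M v /\ v N <> 0); last first.
  move=> /forallNP noV; exists C => // z Mz.
  have zN : z N = 0 by apply: contrapT => zN; apply: (noV z).
  apply: le_trans (CM z (conj Mz zN)) _; rewrite ler_wpM2l//.
  by rewrite big_nat_recr//= lerDl sqr_ge0.
pose V := rnorm v ^+ 2 / normc (v N) ^+ 2.
have vN0 := normc_sqr_gt0 vN.
have V0 : 0 <= V by rewrite divr_ge0 ?sqr_ge0.
exists (4 * C + 4 * C * V + 2 * V) => [|z Mz]; first by nra.
pose k := - (z N / v N); pose u := k *: v + z.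
have Mu : (M `&` [set z | z N = 0]) u.
  split; first exact: Mlin.
  by rewrite /= -[LHS]/(k * v N + z N) /k mulNr divfK// addNr.
have kE : normc k ^+ 2 * rnorm v ^+ 2 = normc (z N) ^+ 2 * V.
  have : normc k ^+ 2 * normc (v N) ^+ 2 = normc (z N) ^+ 2.
    by rewrite -exprMn -normcM /k mulNr divfK// normcN.
  by move=> <-; rewrite /V [RHS]mulrACA divff ?mulr1 ?gt_eqF.
have zu : rnorm z ^+ 2 <= 2 * rnorm u ^+ 2 + 2 * (normc (z N) ^+ 2 * V).
  rewrite -kE -exprMn -rnormZ; have := rnormD u (- (k *: v)); rewrite rnormN.
  rewrite {1}/u addrC addKr; have := rnorm_ge0 z; have := sqr_ge0 (rnorm u - rnorm (k *: v)).
  move: (rnorm z) (rnorm u) (rnorm (k *: v)) => r p q; nra.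
have uC : rnorm u ^+ 2 <= C * (2 * (normc (z N) ^+ 2 * V) +
    2 * \sum_(0 <= n < N) normc (z n) ^+ 2).
  apply: le_trans (CM u Mu) _; rewrite ler_wpM2l//.
  apply: (@le_trans _ _ (2 * \sum_(0 <= n < N) normc ((k *: v) n) ^+ 2 +
                         2 * \sum_(0 <= n < N) normc (z n) ^+ 2)).
    by rewrite !mulr_sumr -big_split /=; apply: ler_sum => n _; exact: normc_sqrD.
  rewrite lerD2r ler_wpM2l// -kE -exprMn -rnormZ; exact: sum_coord_le_rnorm.
have S0 : 0 <= \sum_(0 <= n < N) normc (z n) ^+ 2.
  by apply: sumr_ge0 => n _; exact: sqr_ge0.
rewrite big_nat_recr//=; have := sqr_ge0 (normc (z N)).
move: S0 zu uC; move: (normc (z N) ^+ 2) (\sum_(0 <= _ < N) _) (rnorm u ^+ 2) => p S r.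
move=> S0 zr rC p0; have := mulr_ge0 C0 p0; have := mulr_ge0 V0 S0.
by have := mulr_ge0 (mulr_ge0 C0 V0) S0; lra.
Qed.

Lemma unit_multiple (S : ell2 R -> ell2 R) z : bounded_operator S -> z != 0 ->
  exists b : R[i], rnorm (b *: z) = 1 /\ rnorm (S (b *: z)) = rnorm (S z) / rnorm z.
Proof.
move=> [Slin _] z0; have zgt := rnorm_gt0 z0; exists ((rnorm z)^-1)%:C%C.
have nb : normc ((rnorm z)^-1)%:C%C = (rnorm z)^-1.
  by rewrite /= expr0n addr0 sqrtr_sqr gtr0_norm ?invr_gt0.
by rewrite linear_opZ// !rnormZ nb mulVf ?gt_eqF// mulrC.
Qed.

(** The supremum in the definition of norm attainment is the operator norm of [S]
    on [M], and it is approached on the unit ball. *)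
Lemma sup_unit_ball (S : ell2 R -> ell2 R) M :
  bounded_operator S -> closed_subspace M ->
  let s := sup [set rnorm (S x) | x in [set x | M x /\ rnorm x <= 1]] in
  [/\ 0 <= s, forall z, M z -> rnorm (S z) <= s * rnorm z &
      forall e, 0 < e -> exists z, [/\ M z, rnorm z <= 1 & s - e < rnorm (S z)]].
Proof.
move=> bS [M0 Mlin _]; have [Slin [K SK]] := bS.
set A := [set _ | _ in _]; move=> s.
have supA : has_sup A.
  split; first by exists (rnorm (S 0)), 0; split=> //; rewrite rnorm0 ler01.
  exists `|K| => _ [z [Mz z1] <-]; apply: le_trans (SK z) _.
  apply: (@le_trans _ _ (`|K| * rnorm z)); first by rewrite ler_wpM2r ?rnorm_ge0 ?ler_norm.
  by rewrite ler_piMr.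
have le_s z : M z -> rnorm z <= 1 -> rnorm (S z) <= s.
  by move=> Mz z1; apply: (sup_upper_bound supA); exists z.
split=> [|z Mz|e e0].
- by apply: le_trans (rnorm_ge0 (S 0)) (le_s 0 M0 _); rewrite rnorm0 ler01.
- have [->|z0] := eqVneq z 0; first by have := SK 0; rewrite rnorm0 !mulr0.
  have [b [b1 bS']] := unit_multiple bS z0.
  rewrite -ler_pdivrMr ?rnorm_gt0// -bS'; apply: le_s; last by rewrite b1.
  by rewrite -[_ *: z]addr0; exact: Mlin.
- by have [_ [z [Mz z1] <-] sz] := sup_adherent e0 supA; exists z.
Qed.

Variables (w : nat -> R[i]) (hw : bounded_sequence w).
Let T := weighted_shift hw.
Let a n : R := normc (w n).

Lemma bounded_weight_modulus_sqr : bounded_weight (fun n => a n ^+ 2).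
Proof.
have [C wC] := hw; exists (C ^+ 2) => n.
by rewrite ger0_norm ?sqr_ge0// lerXn2r ?nnegrE ?normc_ge0// (le_trans _ (wC n)) ?normc_ge0.
Qed.

Lemma rnorm_weighted_shift x : rnorm (T x) ^+ 2 = energy (fun n => a n ^+ 2) x.
Proof.
rewrite rnormE sqr_sqrtr; last exact: le_trans (sqr_ge0 _) (ell2_ge_coord _ 0).
rewrite /energy; apply/cvg_lim => //; rewrite -cvg_shiftS.
rewrite (@series_shift _ (fun n => normc (T x n) ^+ 2)) /=; last first.
  by rewrite expr0n/= addr0 sqrtr0 expr0n.
rewrite (_ : (fun n => normc (w n * x n) ^+ 2) = (fun n => a n ^+ 2 * normc (x n) ^+ 2)).
  exact/energy_cvg/bounded_weight_modulus_sqr.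
by apply/funext => n; rewrite normcM exprMn.
Qed.

Lemma bounded_operator_weighted_shift : bounded_operator T.
Proof.
split.
  move=> b x y; apply: ell2P => -[|n] /=; first by rewrite -[RHS]/(b * 0 + 0) mulr0 addr0.
  by rewrite -[LHS]/(w n * (b * x n + y n)) mulrDr mulrCA.
have [C wC] := hw; exists C => x.
have C0 : 0 <= C by exact: le_trans (normc_ge0 _) (wC 0%N).
rewrite -(@ler_pXn2r _ 2) ?nnegrE ?rnorm_ge0 ?mulr_ge0 ?rnorm_ge0//.
rewrite rnorm_weighted_shift exprMn -energy_cst; apply: energy_le => [||n].
- exact: bounded_weight_modulus_sqr.
- exact: bounded_weight_cst.
- by rewrite ler_wpM2r ?sqr_ge0// lerXn2r ?nnegrE ?normc_ge0//; exact: wC.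
Qed.

Lemma absolutely_norm_attaining_of_cvg (alpha : R) :
  cvg_from_above a alpha -> absolutely_norm_attaining T.
Proof.
move=> [acvg [N0 _ aN0]]; split; first exact: bounded_operator_weighted_shift.
have alpha0 : 0 <= alpha.
  by apply: (@le_trans _ _ (limn a)); [apply: limr_ge; [apply/cvg_ex; exists alpha|
    apply: nearW => n; exact: normc_ge0]|rewrite (cvg_lim _ acvg)].
have bT := bounded_operator_weighted_shift.
move=> M clM _ /=; have [_ Mlin _] := clM; have [M0 _ _] := clM.
have := sup_unit_ball bT clM; move: (sup _) => s [s0 Ts smax].
suff [x [Mx x1 sx]] : exists x, [/\ M x, rnorm x <= 1 & s <= rnorm (T x)].
  exists x => //; apply/le_anti; rewrite sx andbT; apply: le_trans (Ts x Mx) _.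
  by rewrite ler_piMr.
(* If [s <= alpha], a nonzero vector vanishing below [N0] has norm ratio at least
   [alpha]; otherwise the coordinates below [N0] are coercive by themselves. *)
have [s_le|s_gt] := leP s alpha.
  have [inj|] := pselect (forall z, M z -> (forall n, (n < N0)%N -> z n = 0) -> z = 0).
    have [C C0 MC] := coord_bound_of_inj Mlin inj.
    apply: (@attained_of_coercive _ T M s C N0) => //.
    move=> z Mz; apply: le_trans (MC z Mz) _; rewrite ler_wpM2l// lerDl subr_ge0.
    by rewrite -exprMn lerXn2r ?nnegrE ?mulr_ge0 ?rnorm_ge0// Ts.
  move=> /existsNP[y /not_implyP[My /not_implyP[yN /eqP y0]]].
  have [b [b1 bTy]] := unit_multiple bT y0.
  exists (b *: y); split; [|by rewrite b1|rewrite bTy].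
    by rewrite -[_ *: y]addr0; exact: Mlin.
  rewrite ler_pdivlMr ?rnorm_gt0//; apply: (@le_trans _ _ (alpha * rnorm y)).
    by rewrite ler_wpM2r ?rnorm_ge0.
  rewrite -(@ler_pXn2r _ 2) ?nnegrE ?rnorm_ge0 ?mulr_ge0 ?rnorm_ge0//.
  rewrite rnorm_weighted_shift exprMn -energy_cst; apply: energy_le => [||n].
  - exact: bounded_weight_cst.
  - exact: bounded_weight_modulus_sqr.
  - have [nN|Nn] := ltnP n N0; first by rewrite yN// normc0 expr0n !mulr0.
    by rewrite ler_wpM2r ?sqr_ge0// lerXn2r ?nnegrE ?normc_ge0//; exact: aN0.
(* If [s > alpha], the weight [s ^+ 2 - a n ^+ 2] is at least [delta] for [n >= N],
   and at least [- D] for the other indices. *)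
have [N _ aN] : \forall n \near \oo, a n < (s + alpha) / 2.
  by apply: cvgr_lt acvg _ _; lra.
pose delta := s ^+ 2 - ((s + alpha) / 2) ^+ 2.
have delta0 : 0 < delta by rewrite subr_gt0 ltrXn2r// ?nnegrE; lra.
have [D aD] := bounded_weight_modulus_sqr.
have aD' n : a n ^+ 2 <= D := le_trans (ler_norm _) (aD n).
have D0 : 0 <= D := le_trans (sqr_ge0 _) (aD' 0%N).
apply: (@attained_of_coercive _ T M s ((delta + D + 1) / delta) N) => //.
   by rewrite divr_ge0 ?(ltW delta0)//; lra.
move=> z Mz; have bi := @bounded_weight_initial R N.
have bz := bounded_weightZ (delta + D) bi; have ba := bounded_weight_modulus_sqr.
have : energy (fun n => delta - (delta + D) * (n < N)%N%:R) z <=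
    energy (fun n => s ^+ 2 - a n ^+ 2) z.
  apply: energy_le => [||n]; do ?exact: (bounded_weightB (bounded_weight_cst _)).
  rewrite ler_wpM2r ?sqr_ge0//; case: ltnP => [nN|Nn].
      by rewrite mulr1; have := aD' n; have := sqr_ge0 s; lra.
    rewrite /= mulr0 subr0 /delta lerD2l lerN2 lerXn2r ?nnegrE ?normc_ge0//; first by lra.
    exact/ltW/aN.
rewrite (energyB _ (bounded_weight_cst _) bz) (energyB _ (bounded_weight_cst _) ba).
rewrite energyZ// !energy_cst energy_initial -rnorm_weighted_shift.
have : 0 <= s ^+ 2 * rnorm z ^+ 2 - rnorm (T z) ^+ 2.
  by rewrite subr_ge0 -exprMn lerXn2r ?nnegrE ?mulr_ge0 ?rnorm_ge0// Ts.
have : 0 <= \sum_(0 <= n < N) normc (z n) ^+ 2 by apply: sumr_ge0 => n _; exact: sqr_ge0.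
move: (\sum_(0 <= _ < N) _) (_ - _ ^+ 2) => p q p0 q0 le_pq.
rewrite mulrAC ler_pdivlMr//; nra.
Qed.

End Sufficiency.

(** * Convergence of the moduli from above is necessary *)

Section Necessity.
Variable R : realType.
Implicit Types (x y z : ell2 R) (M : set (ell2 R)).

Fact basis_vector_subproof (n : nat) :
  (fun k => (k == n)%:R) \in @square_summable R.
Proof.
apply/square_summableP; apply: nondecreasing_is_cvgn.
  by apply: nondecreasing_series => i _ _; exact: sqr_ge0.
exists 1 => _ [N _ <-]; rewrite /series /=.
suff -> : \sum_(0 <= k < N) normc (k == n)%:R ^+ 2 = (n < N)%N%:R :> R by case: (n < N)%N.
elim: N => [|N IH]; first by rewrite big_geq.
rewrite big_nat_recr//= IH [in RHS]ltnS [in RHS]leq_eqVlt [in RHS]eq_sym; have [->|_] := eqVneq N n.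
  by rewrite ltnn normc1 expr1n add0r.
by rewrite normc0 expr0n addr0.
Qed.

Definition basis_vector n : ell2 R := Ell2 (basis_vector_subproof n).

Lemma basis_vectorE n k : basis_vector n k = (k == n)%:R.
Proof. by []. Qed.

(** All counterexample subspaces below are cut out by relations of this form;
    [r = 0] expresses that a coordinate vanishes. *)
Lemma closed_subspace_coord_rel (E : nat -> R[i] -> nat -> Prop) :
  closed_subspace [set x : ell2 R | forall p r q, E p r q -> x p = r * x q].
Proof.
split=> [p r q _|b x y Ex Ey p r q Epq|]; first by rewrite /= mulr0.
  rewrite -[LHS]/(b * x p + y p) -[RHS]/(r * (b * x q + y q)).
  by rewrite (Ex _ _ _ Epq) (Ey _ _ _ Epq) mulrDr mulrCA.
apply/closed_rnormP => x xE p r q Epq.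
apply/eqP; rewrite -subr_eq0; apply/eqP/eq0_normc/le_anti; rewrite normc_ge0 andbT.
apply/ler_addgt0Pr => e e0; rewrite add0r.
have r0 : 0 < 1 + normc r by rewrite ltr_pwDl ?normc_ge0.
have [|y Ey yx] := xE (e / (1 + normc r)); first exact: divr_gt0.
have -> : x p - r * x q = r * (y - x) q - (y - x) p.
  rewrite -[(y - x) q]/(y q - x q) -[(y - x) p]/(y p - x p) (Ey _ _ _ Epq); ring.
apply: le_trans (le_normcD _ _) _; rewrite normcN normcM.
have := coord_le_rnorm (y - x) p; have := coord_le_rnorm (y - x) q.
move: yx; rewrite ltr_pdivlMr// => yx qx px.
apply: le_trans (ltW yx); rewrite mulrDr mulr1 addrC lerD// mulrC.
by rewrite ler_wpM2r ?normc_ge0.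
Qed.

Lemma sum_sparse (f : nat -> R) (m : nat -> nat) :
  {homo m : i j / (i < j)%N} -> (forall n, ~ range m n -> f n = 0) ->
  forall k, \sum_(0 <= n < m k) f n = \sum_(0 <= j < k) f (m j).
Proof.
move=> mlt f0; have mle i j : (m i < m j)%N -> (i < j)%N.
  by rewrite !ltnNge; apply: contra; rewrite leq_eqVlt => /orP[/eqP->//|/mlt/ltnW].
elim=> [|k IH].
  rewrite [RHS]big_geq// big_nat big1// => n /= nm; apply: f0 => -[j _ mj].
  by have := mle j 0%N; rewrite mj => /(_ nm).
rewrite (@big_cat_nat _ _ _ (m k)) ?(ltnW (mlt _ _ (ltnSn k)))//= IH.
rewrite [RHS]big_nat_recr//=; congr (_ + _).
rewrite big_ltn ?mlt// big_nat big1 ?addr0// => n /andP[kn nk]; apply: f0 => -[j _ mj].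
by move: kn nk; rewrite -mj => /mle kj /mle; rewrite ltnS leqNgt kj.
Qed.

Lemma sum_double (f : nat -> R) k :
  \sum_(0 <= j < k.*2) f j = \sum_(0 <= i < k) (f i.*2 + f i.*2.+1).
Proof.
elim: k => [|k IH]; first by rewrite !big_geq.
by rewrite doubleS !big_nat_recr//= IH addrA.
Qed.

(** The terms of a pair may have opposite signs, so the partial sums are not
    monotone; but the energy is the limit of the partial sums that end with a
    complete pair, and these are sums of nonnegative numbers. *)
Lemma energy_ge_pair (c : nat -> R) x (m : nat -> nat) (k : nat) :
  bounded_weight c -> {homo m : i j / (i < j)%N} ->
  (forall n, ~ range m n -> x n = 0) ->
  let pair j := c (m j.*2) * normc (x (m j.*2)) ^+ 2 +
                c (m j.*2.+1) * normc (x (m j.*2.+1)) ^+ 2 in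
  (forall j, 0 <= pair j) -> pair k <= energy c x.
Proof.
move=> bc mlt x0 pair pair0; pose S := series (fun n => c n * normc (x n) ^+ 2).
have m_oo : (fun i => m i.*2) @ \oo --> \oo.
  move=> A [N _ NA]; exists N => // i /= Ni; apply: NA => /=.
  apply: leq_trans Ni (leq_trans _ (_ : i.*2 <= _)%N); first by rewrite -addnn leq_addr.
  by elim: i.*2 => // j /leq_ltn_trans; apply; exact: mlt.
have Scvg : (fun i => S (m i.*2)) @ \oo --> energy c x.
  have Sl : S @ \oo --> energy c x by exact: energy_cvg x bc.
  by have := cvg_comp _ _ m_oo Sl; exact.
rewrite -(cvg_lim (@Rhausdorff R) Scvg); apply: limr_ge; first by apply/cvg_ex; exists (energy c x).
exists k.+1 => // i /= ki; rewrite /S /series /= (sum_sparse mlt) ?sum_double.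
  rewrite (bigD1_seq k) ?iota_uniq ?mem_index_iota//= lerDl.
  by apply: sumr_ge0 => j _; exact: pair0.
by move=> n nm; rewrite x0// normc0 expr0n mulr0.
Qed.

Variables (w : nat -> R[i]) (hw : bounded_sequence w).
Let T := weighted_shift hw.
Let a n : R := normc (w n).

(** A subspace on which [L] is a strict bound for [|T x| / |x|] although no smaller
    constant is a bound has a norm that is not attained. *)
Lemma not_absolutely_norm_attaining M (L : R) :
  closed_subspace M -> (exists2 x, M x & x != 0) -> 0 < L ->
  (forall x, M x -> x != 0 -> rnorm (T x) < L * rnorm x) ->
  (forall s, 0 <= s -> (forall x, M x -> rnorm (T x) <= s * rnorm x) -> L <= s) ->
  ~ absolutely_norm_attaining T.
Proof.
move=> clM Mn0 L0 TL Lmin [bT /(_ M clM Mn0)[x0 [Mx x1]]].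
have := sup_unit_ball bT clM; move: (sup _) => s /= [s0 Ts _] Tx0.
have Ls := Lmin s s0 Ts; have [x00|xn0] := eqVneq x0 0.
  have [Tlin _] := bT.
  by move: Tx0 Ls; rewrite x00 (linear_op0 Tlin) rnorm0 => <-; rewrite leNgt L0.
have := TL x0 Mx xn0; rewrite Tx0 ltNge => /negP; apply.
by apply: le_trans Ls; rewrite ler_piMr// ltW.
Qed.

(** On the vectors supported where [a n < alpha] the norm is [alpha], the limit of
    strictly smaller moduli. *)
Lemma not_attaining_of_low_moduli (alpha : R) :
  a @ \oo --> alpha -> (forall N, exists2 n, (N <= n)%N & a n < alpha) ->
  ~ absolutely_norm_attaining T.
Proof.
move=> acvg low; pose E p (r : R[i]) (q : nat) := alpha <= a p /\ r = 0.
have clM := closed_subspace_coord_rel E.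
have basisM n : a n < alpha -> forall p r q, E p r q -> basis_vector n p = r * basis_vector n q.
  move=> an p r q [ap ->]; rewrite mul0r basis_vectorE.
  by have [pn|] := eqVneq p n => //; move: ap; rewrite pn leNgt an.
have basis0 n : basis_vector n != 0.
  apply/eqP => /(congr1 (fun x : ell2 R => x n)); rewrite basis_vectorE eqxx.
  by move/eqP; rewrite oner_eq0.
have [n0 _ an0] := low 0%N.
have alpha0 : 0 < alpha by apply: le_lt_trans an0; exact: normc_ge0.
have ba := bounded_weight_modulus_sqr hw.
apply: (not_absolutely_norm_attaining clM _ alpha0).
- by exists (basis_vector n0) => //; exact: basisM.
- move=> x Mx xn0.
  have xhigh n : alpha <= a n -> x n = 0.
    by move=> an; rewrite (Mx n 0 n) ?mul0r.
  have [n xn] := ell2_neq0P xn0.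
  have an : a n < alpha by rewrite ltNge; apply: contra xn => /xhigh/eqP.
  have : 0 < energy (fun n => alpha ^+ 2 - a n ^+ 2) x.
    apply: lt_le_trans (@energy_ge_coord _ _ x n _ _).
    + rewrite mulr_gt0 ?subr_gt0 ?ltrXn2r ?nnegrE ?normc_ge0 ?(ltW alpha0)//.
      exact: normc_sqr_gt0.
    + exact: (bounded_weightB (bounded_weight_cst _)).
    + move=> k; have [ak|ak] := leP alpha (a k); first by rewrite xhigh// normc0 expr0n mulr0.
      rewrite mulr_ge0 ?sqr_ge0// subr_ge0 lerXn2r ?nnegrE ?normc_ge0 ?(ltW alpha0)//.
      exact: ltW.
  rewrite (energyB _ (bounded_weight_cst _) ba) energy_cst -(rnorm_weighted_shift hw).
  rewrite subr_gt0 -exprMn ltr_pXn2r// ?nnegrE ?rnorm_ge0//.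
  by rewrite mulr_ge0 ?rnorm_ge0 ?(ltW alpha0).
- move=> s s0 Ts; rewrite leNgt; apply/negP => s_lt.
  have [N _ Na] : \forall n \near \oo, s < a n by apply: cvgr_gt acvg _ _.
  have [n Nn an] := low N; have := Ts _ (basisM n an).
  rewrite leNgt => /negP; apply.
  apply: (@lt_le_trans _ _ (a n * rnorm (basis_vector n))).
    by rewrite ltr_pM2r ?rnorm_gt0//; exact: Na.
  rewrite -(@ler_pXn2r _ 2) ?nnegrE ?rnorm_ge0 ?mulr_ge0 ?rnorm_ge0 ?normc_ge0//.
  rewrite exprMn -energy_cst rnorm_weighted_shift.
  apply: energy_le => // [|k]; first exact: bounded_weight_cst.
  by rewrite basis_vectorE; have [->//|_] := eqVneq k n; rewrite normc0 expr0n !mulr0.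
Qed.

Lemma interleaved_subsequence (P Q : nat -> Prop) :
  (forall N, exists2 n, (N <= n)%N & P n) -> (forall N, exists2 n, (N <= n)%N & Q n) ->
  exists m : nat -> nat, [/\ {homo m : i j / (i < j)%N},
    forall k, P (m k.*2) & forall k, Q (m k.*2.+1)].
Proof.
move=> /(_ _)/cid2-/all_sig2[f fN fP] /(_ _)/cid2-/all_sig2[g gN gQ].
pose m := fix m k := if k is j.+1 then (if odd j then f else g) (m j).+1 else f 0%N.
exists m; split=> [|k|k].
- apply: homo_ltn => [y x z|i]; first exact: ltn_trans.
  by rewrite /=; case: (odd i); [exact: fN|exact: gN].
- by case: k => [|k]; rewrite ?doubleS /= ?odd_double//=; exact: fP.
- by rewrite /= odd_double; exact: gQ.
Qed.

(** With low indices [p k] and high indices [q k] interleaved, [M] is spanned by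
    the vectors [v k] supported on [p k] and [q k] whose slope [r k] is chosen such
    that [|T (v k)|^2 = t k * |v k|^2], where [t k] increases strictly to [c ^+ 2].
    These vectors and their images are orthogonal, so the norm on [M] is [c], and
    it is not attained. *)
Lemma not_attaining_of_two_levels (b c : R) : b < c ->
  (forall N, exists2 n, (N <= n)%N & a n <= b) ->
  (forall N, exists2 n, (N <= n)%N & c <= a n) ->
  ~ absolutely_norm_attaining T.
Proof.
move=> bc low high; have [m [mlt mb mc]] := interleaved_subsequence low high.
have minj : injective m.
  move=> i j mij; apply/eqP; rewrite eqn_leq; apply/andP; split; rewrite leqNgt;
    by apply/negP => /mlt; rewrite mij ltnn.
have b0 : 0 <= b by apply: le_trans (mb 0%N); exact: normc_ge0.
have c0 : 0 < c by exact: le_lt_trans bc.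
have bc2 : b ^+ 2 < c ^+ 2 by rewrite ltrXn2r// nnegrE ltW.
pose p k := m k.*2; pose q k := m k.*2.+1.
pose t (k : nat) : R := c ^+ 2 - (c ^+ 2 - b ^+ 2) / k.+2%:R.
have tc k : t k < c ^+ 2 by rewrite ltrBlDr ltrDl divr_gt0 ?subr_gt0.
have bt k : b ^+ 2 < t k.
  rewrite ltrBrDr -ltrBrDl ltr_pdivrMr// ltr_pMr ?subr_gt0//.
  by rewrite (ltr_nat R 1).
have pt k : a (p k) ^+ 2 < t k.
  by apply: le_lt_trans (bt k); rewrite lerXn2r ?nnegrE ?normc_ge0//; exact: mb.
have tq k : t k < a (q k) ^+ 2.
  by apply: lt_le_trans (tc k) _; rewrite lerXn2r ?nnegrE ?normc_ge0 ?(ltW c0)//; exact: mc.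
pose r k := Num.sqrt ((t k - a (p k) ^+ 2) / (a (q k) ^+ 2 - t k)).
have r2 k : r k ^+ 2 * (a (q k) ^+ 2 - t k) = t k - a (p k) ^+ 2.
  rewrite sqr_sqrtr ?divfK// ?gt_eqF ?subr_gt0//.
  by rewrite divr_ge0// subr_ge0 ltW.
(* [M] consists of the [x] supported on the range of [m] with
   [x (q k) = r k * x (p k)] for all [k]. *)
pose E i (s : R[i]) j := ~ range m i /\ s = 0 \/
  exists k, [/\ i = q k, s = (r k)%:C%C & j = p k].
have clM := closed_subspace_coord_rel E; set M := [set x | _] in clM.
have M_off x : M x -> forall n, ~ range m n -> x n = 0.
  by move=> Mx n nm; rewrite (Mx n 0 n) ?mul0r//; left.
have M_q x k : M x -> x (q k) = (r k)%:C%C * x (p k).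
  by move=> Mx; apply: Mx; right; exists k.
have M_pair x k (s : R) : M x ->
    (s - a (p k) ^+ 2) * normc (x (p k)) ^+ 2 + (s - a (q k) ^+ 2) * normc (x (q k)) ^+ 2 =
    (s - t k) * ((1 + r k ^+ 2) * normc (x (p k)) ^+ 2).
  move=> Mx; rewrite M_q// normcM exprMn.
  have -> : normc (r k)%:C%C ^+ 2 = r k ^+ 2.
    by rewrite /= expr0n addr0 sqr_sqrtr ?sqr_ge0.
  have -> : a (p k) ^+ 2 = t k - r k ^+ 2 * (a (q k) ^+ 2 - t k) by rewrite r2 subKr.
  ring.
pose v k := basis_vector (p k) + (r k)%:C%C *: basis_vector (q k).
have vE k n : v k n = (n == p k)%:R + (r k)%:C%C * (n == q k)%:R by [].
have vp j k : v k (p j) = (j == k)%:R.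
  rewrite vE !(inj_eq minj) (inj_eq double_inj).
  rewrite (_ : (j.*2 == k.*2.+1) = false) ?mulr0 ?addr0//.
  by apply/negP => /eqP/(congr1 odd); rewrite /= !odd_double.
have vq j k : v k (q j) = (r k)%:C%C * (j == k)%:R.
  rewrite vE !(inj_eq minj) eqSS (inj_eq double_inj).
  rewrite (_ : (j.*2.+1 == k.*2) = false) ?add0r//.
  by apply/negP => /eqP/(congr1 odd); rewrite /= !odd_double.
have Mv k : M (v k).
  move=> i s j [[im ->]|[l [-> -> ->]]].
    rewrite mul0r vE; have [ip|_] := eqVneq i (p k); first by case: im; exists k.*2.
    have [iq|_] := eqVneq i (q k); first by case: im; exists k.*2.+1.
    by rewrite mulr0 addr0.
  by rewrite vp vq; have [->//|_] := eqVneq l k; rewrite !mulr0.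
have v_neq0 k : v k != 0.
  apply/eqP => /(congr1 (fun x : ell2 R => x (p k))); rewrite vp eqxx.
  by move/eqP; rewrite oner_eq0.
have ba := bounded_weight_modulus_sqr hw.
apply: (not_absolutely_norm_attaining clM _ c0).
- by exists (v 0%N).
- move=> x Mx xn0; have [k xk] : exists k, x (p k) != 0.
    have [n xn] := ell2_neq0P xn0; apply: contrapT => /forallNP xz.
    have xp k : x (p k) = 0.
      by apply/eqP; rewrite -[_ == _]negbK; apply/negP; exact: xz.
    move/eqP: xn; apply.
    have [[j _ <-]|] := pselect (range m n); last exact: M_off.
    rewrite -[j]odd_double_half; case: (odd j); last exact: xp.
    by rewrite add1n (M_q x j./2 Mx) xp mulr0.
  have : 0 < energy (fun n => c ^+ 2 - a n ^+ 2) x.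
    apply: lt_le_trans (@energy_ge_pair _ x m k _ mlt (M_off x Mx) _).
    + rewrite (M_pair x k _ Mx) mulr_gt0 ?subr_gt0// mulr_gt0 ?normc_sqr_gt0//.
      by rewrite ltr_wpDr ?sqr_ge0.
    + exact: (bounded_weightB (bounded_weight_cst _)).
    + move=> j; rewrite (M_pair x j _ Mx) mulr_ge0 ?subr_ge0 ?(ltW (tc j))//.
      by rewrite mulr_ge0 ?sqr_ge0// addr_ge0 ?sqr_ge0.
  rewrite (energyB _ (bounded_weight_cst _) ba) energy_cst -(rnorm_weighted_shift hw).
  rewrite subr_gt0 -exprMn ltr_pXn2r// ?nnegrE ?rnorm_ge0//.
  by rewrite mulr_ge0 ?rnorm_ge0 ?(ltW c0).
- move=> s s0 Ts; have ts k : t k <= s ^+ 2.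
    have : 0 <= energy (fun n => a n ^+ 2 - t k) (v k).
      have pairE j : (a (p j) ^+ 2 - t k) * normc (v k (p j)) ^+ 2 +
                     (a (q j) ^+ 2 - t k) * normc (v k (q j)) ^+ 2 = 0.
        have := M_pair _ j (t k) (Mv k); rewrite vp.
        have [->|_] := eqVneq j k; first by rewrite subrr mul0r; lra.
        by rewrite normc0 expr0n !mulr0; lra.
      rewrite -(pairE k); apply: (@energy_ge_pair (fun n => a n ^+ 2 - t k) _ m k
        _ mlt (M_off _ (Mv k))) => [|j].
        exact: (bounded_weightB _ (bounded_weight_cst _)).
      by rewrite pairE.
    rewrite (energyB _ ba (bounded_weight_cst _)) energy_cst -(rnorm_weighted_shift hw).
    rewrite subr_ge0 => tv; have vgt : 0 < rnorm (v k) ^+ 2 by rewrite exprn_gt0 ?rnorm_gt0.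
    rewrite -(ler_pM2r vgt); apply: le_trans tv _; rewrite -exprMn.
    by rewrite lerXn2r ?nnegrE ?mulr_ge0 ?rnorm_ge0//; exact: Ts.
  rewrite leNgt; apply/negP => sc.
  have sc2 : 0 < c ^+ 2 - s ^+ 2 by rewrite subr_gt0 ltrXn2r// nnegrE ltW.
  have /archi_boundP : 0 <= (c ^+ 2 - b ^+ 2) / (c ^+ 2 - s ^+ 2).
    by rewrite divr_ge0 ?(ltW sc2)// subr_ge0 ltW.
  set k := Num.bound _ => kb; have := ts k; rewrite leNgt => /negP; apply.
  rewrite /t ltrBrDr -ltrBrDl ltr_pdivrMr// mulrC -ltr_pdivrMr//.
  by apply: lt_trans kb _; rewrite ltr_nat.
Qed.

(** The limit is taken to be the upper limit of the moduli: a lower limit below it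
    would give two levels. *)
Lemma cvg_of_absolutely_norm_attaining :
  absolutely_norm_attaining T -> exists alpha, cvg_from_above a alpha.
Proof.
move=> anT; have [C aC] := hw.
pose A := [set t : R | forall N, exists2 n, (N <= n)%N & t <= a n].
have supA : has_sup A.
  split; first by exists 0 => N; exists N => //; exact: normc_ge0.
  by exists C => t /(_ 0%N)[n _ /le_trans]; apply; exact: aC.
have eventually (P : nat -> Prop) : ~ (forall N, exists2 n, (N <= n)%N & ~ P n) ->
    \forall n \near \oo, P n.
  move=> /existsNP[N] NP; exists N => // n /= Nn; apply: contrapT => nP.
  by apply: NP; exists n.
have acvg : a @ \oo --> sup A.
  apply/cvgrPdist_lt => e e0; have e2 : 0 < e / 2 by rewrite divr_gt0.
  have up : \forall n \near \oo, a n < sup A + e.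
    apply: eventually => high; have : sup A + e <= sup A.
      apply: (sup_upper_bound supA) => N; have [n Nn an] := high N.
      by exists n => //; rewrite leNgt; apply/negP.
    by rewrite gerDl leNgt e0.
  have down : \forall n \near \oo, sup A - e < a n.
    apply: eventually => low; have [t At tA] := sup_adherent e2 supA.
    apply: (@not_attaining_of_two_levels (sup A - e) t) => //; first by lra.
    move=> N; have [n Nn an] := low N.
    by exists n => //; rewrite leNgt; apply/negP.
  near=> n; rewrite distrC ltr_distl; apply/andP; split.
    by near: n; exact: down.
  by near: n; exact: up.
exists (sup A); split=> //; apply: eventually => low.
apply: (not_attaining_of_low_moduli acvg _ anT) => N; have [n Nn an] := low N.
by exists n => //; rewrite ltNge; apply/negP.
Unshelve. all: by end_near.
Qed.

End Necessity.

(** * The absolute value of the shift and its spectrum *)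

Section AbsoluteValue.
Variable R : realType.
Implicit Types (x y z : ell2 R) (P : ell2 R -> ell2 R).

Lemma csum_single (u : nat -> R[i]) n : (forall k, k != n -> u k = 0) -> csum u = u n.
Proof.
move=> u0; have lim_single (f : nat -> R) :
    (forall k, k != n -> f k = 0) -> limn (series f) = f n.
  move=> f0; apply/cvg_lim => //; apply: cvg_near_cst; exists n.+1 => // N /= nN.
  rewrite /series /= (bigD1_seq n) ?iota_uniq ?mem_index_iota//=.
  by rewrite big1 ?addr0// => k; exact: f0.
by rewrite /csum !lim_single => [|k /u0->//|k /u0->//]; case: (u n).
Qed.

Lemma ell2_dot_basis x n : ell2_dot x (basis_vector R n) = x n.
Proof.
rewrite /ell2_dot (@csum_single _ n) => [|k kn]; rewrite basis_vectorE.
  by rewrite eqxx conjC1 mulr1.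
by rewrite (negbTE kn) conjC0 mulr0.
Qed.

Lemma ell2_dotD x y z : ell2_dot (x + y) z = ell2_dot x z + ell2_dot y z.
Proof. by rewrite -[x in LHS]scale1r ell2_dot_linear mul1r. Qed.

Lemma ell2_dotZ (b : R[i]) x y : ell2_dot (b *: x) y = b * ell2_dot x y.
Proof.
have dot0 : ell2_dot 0 y = 0 by rewrite -[0 in LHS](scale0r (0 : ell2 R)) linearZl_LR /= mul0r.
by rewrite -[_ *: _]addr0 ell2_dot_linear dot0 addr0.
Qed.

Lemma ell2_dotDr x y z : ell2_dot x (y + z) = ell2_dot x y + ell2_dot x z.
Proof. by rewrite ell2_dotC ell2_dotD rmorphD /= -!ell2_dotC. Qed.

Lemma ell2_dotZr (b : R[i]) x y : ell2_dot x (b *: y) = b^* * ell2_dot x y.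
Proof. by rewrite ell2_dotC ell2_dotZ rmorphM /= -ell2_dotC. Qed.

Lemma ell2_dot_eq0 x : ell2_dot x x = 0 -> x = 0.
Proof. by move=> xx; apply/eqP; apply: contraT => /ell2_dot_gt0; rewrite xx ltxx. Qed.

(** Polarization: positivity at [x + y] and at [x + i y] makes the sesquilinear form
    of [P] hermitian. *)
Lemma positive_operator_selfadjoint P : linear P -> positive_operator P ->
  forall x y, ell2_dot (P x) y = ell2_dot x (P y).
Proof.
move=> Plin Ppos x y; rewrite [RHS]ell2_dotC.
have PD u v : P (u + v) = P u + P v by exact: linear_opD.
have PZ b u : P (b *: u) = b *: P u by exact: linear_opZ.
have := Ppos (x + y); have := Ppos (x + Complex 0 1 *: y); have := Ppos x; have := Ppos y.
rewrite !PD PZ !ell2_dotD !ell2_dotDr !ell2_dotZ !ell2_dotZr.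
case: (ell2_dot (P x) y) => f1 f2; case: (ell2_dot (P y) x) => g1 g2.
case: (ell2_dot (P x) x) => h1 h2; case: (ell2_dot (P y) y) => k1 k2.
rewrite !lecE /=; move=> /andP[/eqP k20 _] /andP[/eqP h20 _] /andP[/eqP fgi _] /andP[/eqP fg _].
by congr Complex; lra.
Qed.

(** Off the range of [d], finiteness of this range bounds the entries
    [(d n - l)^-1] of the inverse. *)
Lemma spectrum_diagonal (d : nat -> R[i]) (hd : bounded_sequence d) :
  finite_set (range d) -> spectrum (Defs.diagonal hd) = range d.
Proof.
move=> /finite_seqP[s ds]; apply/seteqP; split=> l /=; last first.
  move=> [n _ <-] [B [[Blin _] BD _]].
  have := BD (basis_vector R n); rewrite (_ : _ - _ = 0); last first.
    apply: ell2P => k; rewrite -[LHS]/(d k * (k == n)%:R - d n * (k == n)%:R) -[RHS]/0.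
    by have [->|_] := eqVneq k n; rewrite ?subrr// !mulr0 subrr.
  rewrite (linear_op0 Blin) => /(congr1 (fun x : ell2 R => x n)); rewrite basis_vectorE eqxx.
  by move/eqP; rewrite eq_sym oner_eq0.
move=> spec_l; apply: contrapT => dl; apply: spec_l.
have dl0 n : d n - l != 0 by rewrite subr_eq0; apply/eqP => dnl; apply: dl; exists n.
have hb : bounded_sequence (fun n => (d n - l)^-1).
  exists (\sum_(z <- s) normc (z - l)^-1) => n.
  have : d n \in s by have : range d (d n) by []; rewrite ds.
  move=> dns; rewrite (big_rem _ dns) /= lerDl; apply: sumr_ge0 => z _; exact: normc_ge0.
exists (Defs.diagonal hb); split=> [|x|x]; first exact: bounded_operator_diagonal.
- apply: ell2P => n; rewrite -[LHS]/((d n - l)^-1 * (d n * x n - l * x n)).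
  by rewrite -mulrBl mulKf.
- apply: ell2P => n.
  rewrite -[LHS]/(d n * ((d n - l)^-1 * x n) - l * ((d n - l)^-1 * x n)).
  by rewrite -mulrBl mulVKf.
Qed.

Variables (w : nat -> R[i]) (hw : bounded_sequence w).
Let T := weighted_shift hw.

Lemma modulusE n : `|w n| = (normc (w n))%:C%C.
Proof. by case: (w n). Qed.

(** Let [P] be the absolute value, [e] the basis vector at [n], [r] the modulus of
    [w n] and [y = P e - r e].  As [P (P e) = r^2 e], [P y = - r y]; positivity of
    [P] then forces [y = 0] if [r > 0], and self-adjointness does if [r = 0].  So
    each basis vector is an eigenvector, and self-adjointness yields the
    coordinates of [P x]. *)
Lemma absolute_value_weighted_shiftE :
  absolute_value T = Defs.diagonal (bounded_sequence_modulus hw).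
Proof.
have [] := absolute_value_weighted_shift hw; rewrite -/T.
move: (absolute_value T) => P [Plin _] Ppos [S ST PP].
have Psa := positive_operator_selfadjoint Plin Ppos.
have PD u v : P (u + v) = P u + P v by exact: linear_opD.
have PZ b u : P (b *: u) = b *: P u by exact: linear_opZ.
have STE x n : S (T x) n = `|w n| ^+ 2 * x n.
  rewrite -ell2_dot_basis ell2_dotC -ST /ell2_dot (@csum_single _ n.+1) => [|[|k] kn].
  - rewrite -[T _ _]/(w n * (n == n)%:R) -[T x _]/(w n * x n) eqxx mulr1.
    by rewrite rmorphM /= conjCK mulrA -normCKC.
  - by rewrite mul0r.
  - by rewrite -[T _ _]/(w k * (k == n)%:R) (negbTE (kn : k != n)) mulr0 mul0r.
have Pe n : P (basis_vector R n) = `|w n| *: basis_vector R n.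
  set e := basis_vector R n; pose y := P e - `|w n| *: e.
  have Py : P y = - (`|w n| *: y).
    rewrite /y -[in LHS]scaleNr PD PZ PP.
    have -> : S (T e) = `|w n| ^+ 2 *: e.
      apply: ell2P => k; rewrite STE -[RHS]/(`|w n| ^+ 2 * e k) /e basis_vectorE.
      by have [->//|_] := eqVneq k n; rewrite !mulr0.
    by rewrite scaleNr scalerBr scalerA -expr2 opprB.
  suff y0 : y = 0 by apply/eqP; rewrite -subr_eq0; apply/eqP.
  apply: ell2_dot_eq0; have [w0|wn0] := eqVneq `|w n| 0.
    by rewrite {1}/y w0 scale0r subr0 Psa Py w0 scale0r oppr0 linear0r.
  have yy0 : 0 <= ell2_dot y y := dnorm_ge0 (@ell2_dot R) y.
  apply/le_anti; rewrite yy0 andbT -(@pmulr_rle0 _ `|w n|) ?lt_def ?wn0 ?normr_ge0//.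
  by have := Ppos y; rewrite Py -scaleNr ell2_dotZ mulNr oppr_ge0.
apply/funext => x; apply: ell2P => n; rewrite -[LHS]ell2_dot_basis Psa Pe ell2_dotZr.
by rewrite ell2_dot_basis conj_Creal ?normr_real.
Qed.

End AbsoluteValue.

(** * Convergence from above in terms of limit points and multiplicities *)

Section Moduli.
Variable R : realType.
Implicit Types (a : nat -> R).

Lemma finite_set_nat_near (A : set nat) :
  finite_set A <-> \forall n \near \oo, ~ A n.
Proof.
split=> [/finite_seqP[s ->]|[N _ NA]].
  exists (\max_(i <- s) i).+1 => // n /= sn ns.
  by move: sn; rewrite ltnNge (@leq_bigmax_seq _ s xpredT id n).
apply: sub_finite_set (finite_II N) => n An /=.
by rewrite ltnNge; apply/negP => Nn; exact: (NA n Nn).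
Qed.

Lemma finite_set_fibers (X : Type) (f : nat -> X) (A : set nat) :
  finite_set (f @` A) -> (forall v, (f @` A) v -> finite_set [set n | f n = v]) ->
  finite_set A.
Proof.
move=> fA fib; apply: (@sub_finite_set _ _ (\bigcup_(v in f @` A) [set n | f n = v])).
  by move=> n An; exists (f n) => //; exists n.
exact: bigcup_finite.
Qed.

Lemma finite_range_of_near (X : Type) (f : nat -> X) (v : X) :
  (\forall n \near \oo, f n = v) -> finite_set (range f).
Proof.
move=> [N _ Nf]; apply: (@sub_finite_set _ _ ([set v] `|` f @` `I_N)).
  move=> _ [n _ <-]; have [nN|Nn] := ltnP n N; first by right; exists n.
  by left; exact: (Nf n Nn).
by rewrite finite_setU; split; [exact: finite_set1|exact: finite_image (finite_II N)].
Qed.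

Lemma near_neq_of_cvg a (alpha beta : R) :
  a @ \oo --> alpha -> beta <> alpha -> \forall n \near \oo, a n <> beta.
Proof.
move=> acvg /eqP ba; have d0 : 0 < `|beta - alpha| by rewrite normr_gt0 subr_eq0.
near=> n; move=> an; have : `|alpha - a n| < `|beta - alpha|.
  by near: n; exact: cvgr_dist_lt.
by rewrite an distrC ltxx.
Unshelve. all: by end_near.
Qed.

Lemma limit_point_of_cvg a (alpha : R) :
  a @ \oo --> alpha -> infinite_set (range a) -> limit_point (range a) = [set alpha].
Proof.
move=> acvg ainf; apply/seteqP; split=> [beta|_ ->] /=.
  move=> /limit_point_infinite_setP lb; apply: contrapT => /eqP ba.
  have d0 : 0 < `|beta - alpha| / 2 by rewrite divr_gt0// normr_gt0 subr_eq0.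
  apply: (lb (ball beta (`|beta - alpha| / 2))); first exact: nbhsx_ballx.
  have [N _ Na] : \forall n \near \oo, `|alpha - a n| < `|beta - alpha| / 2.
    exact: cvgr_dist_lt.
  apply: sub_finite_set (finite_image a (finite_II N)) => r [+ [n _ anr]].
  rewrite -anr => ban.
  exists n => //=; rewrite ltnNge; apply/negP => /Na /= an.
  move: ban; rewrite -ball_normE /= => ban.
  have := ler_normD (beta - a n) (a n - alpha); rewrite subrKA (distrC (a n)).
  by rewrite [X in X <= _](splitr _) leNgt ltrD.
move=> U aU; apply: contrapT => noU; apply: ainf.
apply: (@finite_range_of_near _ a alpha); near=> n; apply: contrapT => /eqP an.
apply: noU; exists (a n); split=> //; near: n; exact: acvg.
Unshelve. all: by end_near.
Qed.

(** Infinitely many terms at distance [e] from [alpha] would either take one value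
    infinitely often, or accumulate by the Bolzano-Weierstrass theorem at a limit
    point other than [alpha]. *)
Lemma cvg_of_unique_limit_point a (alpha : R) : bounded_set (range a) ->
  limit_point (range a) = [set alpha] ->
  (forall beta, beta <> alpha -> finite_set [set n | a n = beta]) ->
  a @ \oo --> alpha.
Proof.
move=> bnd lp fib; apply/cvgrPdist_lt => e e0.
pose A := [set n | e <= `|alpha - a n|].
suff /finite_set_nat_near : finite_set A.
  by apply: filterS => n /negP; rewrite -ltNge.
have Aalpha v : (a @` A) v -> v <> alpha.
  by move=> [n An <-] an; move: An; rewrite /A /= an subrr normr0 leNgt e0.
apply: (@finite_set_fibers _ a) => [|v /Aalpha/fib//]; apply: contrapT => Ainf.
have [|l Al] := infinite_bounded_limit_point_nonempty Ainf.
  have [C [Cr bC]] := bnd; exists C; split=> // D CD _ [n _ <-].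
  by apply: (bC D CD); exists n.
have : limit_point (range a) l.
  by move=> U /Al[y [yl [n _ any] Uy]]; exists y; split=> //; exists n.
rewrite lp /= => la; rewrite la in Al.
have [y [_ [n An <-]]] := Al (ball alpha e) (nbhsx_ballx _ _ e0).
by rewrite -ball_normE /= ltNge An.
Qed.

End Moduli.

(** * The characterization *)

Theorem mainTheorem2 (R : realType) (w : nat -> R[i]) (hw : bounded_sequence w) :
  absolutely_norm_attaining (weighted_shift hw) <->
  (exists alpha : R,
     [/\ limit_point (range (fun n => normc (w n))) = [set alpha],
         (forall beta : R, beta <> alpha ->
            finite_set [set n | normc (w n) = beta]) &
         finite_set [set n | normc (w n) < alpha]])
  \/
  (let sigma := spectrum (absolute_value (weighted_shift hw)) in
   [/\ sigma = range (fun n => `|w n|),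
       finite_set sigma &
       exists! beta : R[i],
         sigma beta /\ infinite_set [set n | `|w n| = beta]]).
Proof.
have modI n k : `|w n| = `|w k| <-> normc (w n) = normc (w k).
  by rewrite !modulusE; split=> [/complexI//|->].
split=> [/cvg_of_absolutely_norm_attaining[alpha [acvg age]]|].
  have [fin|inf] := pselect (finite_set (range (fun n => normc (w n)))); last first.
    left; exists alpha; split; first exact: limit_point_of_cvg.
    - by move=> beta ba; apply/finite_set_nat_near; exact: near_neq_of_cvg acvg ba.
    - by apply/finite_set_nat_near; apply: filterS age => n an; apply/negP; rewrite -leNgt.
  right=> sigma; have fin' : finite_set (range (fun n => `|w n|)).
    apply: sub_finite_set (finite_image (fun r : R => r%:C%C) fin) => _ [n _ <-].
    by exists (normc (w n)); [exists n|rewrite modulusE].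
  have sigmaE : sigma = range (fun n => `|w n|).
    by rewrite /sigma absolute_value_weighted_shiftE spectrum_diagonal.
  have fib beta : beta <> alpha -> finite_set [set n | normc (w n) = beta].
    by move=> ba; apply/finite_set_nat_near; exact: near_neq_of_cvg acvg ba.
  have aE : \forall n \near \oo, normc (w n) = alpha.
    suff /finite_set_nat_near : finite_set [set n | normc (w n) <> alpha].
      by apply: filterS => n; exact: contrapT.
    apply: (@finite_set_fibers _ (fun n => normc (w n))).
      by apply: sub_finite_set fin => _ [n _ <-]; exists n.
    by move=> _ [n na <-]; exact: fib.
  split=> //; first by rewrite sigmaE.
  exists alpha%:C%C; split; rewrite sigmaE.
    split.
      by have [n an] := filter_ex aE; exists n => //; rewrite modulusE an.
    move=> /finite_set_nat_near an; have [n [an1]] := filter_ex (filterI aE an).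
    by apply; rewrite /= modulusE an1.
  move=> _ [[n _ <-] ninf]; rewrite modulusE; congr (_%:C%C); apply: contrapT => na.
  apply: ninf; apply: sub_finite_set (fib (normc (w n)) (fun e => na (esym e))) => k /=.
  by move/modI.
move=> H; suff [alpha avg] : exists alpha, cvg_from_above (fun n => normc (w n)) alpha.
  exact: absolutely_norm_attaining_of_cvg avg.
case: H => [[alpha [lp fib low]]|/= [-> fin [beta [[[k _ <-] _] uniq]]]].
  exists alpha; split.
    apply: cvg_of_unique_limit_point lp fib.
    have [C wC] := hw; exists C; split; first exact: num_real.
    move=> r Cr _ [n _ <-] /=; rewrite ger0_norm ?normc_ge0//.
    exact: le_trans (wC n) (ltW Cr).
  by move/finite_set_nat_near : low; apply: filterS => n /negP; rewrite -leNgt.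
have aE : \forall n \near \oo, normc (w n) = normc (w k).
  suff /finite_set_nat_near : finite_set [set n | `|w n| <> `|w k|].
    by apply: filterS => n /contrapT/modI.
  apply: (@finite_set_fibers _ (fun n => `|w n|)).
    by apply: sub_finite_set fin => _ [n _ <-]; exists n.
  move=> _ [n nk <-]; apply: contrapT => ninf; apply: nk.
  by apply/esym/uniq; split => //; exists n.
exists (normc (w k)); split; last by apply: filterS aE => n ->.
exact: cvg_near_cst.
Qed.
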